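(* There exists a complex affine algebra $R$ equipped with a derivation $\delta$ such that (i) the field of constants $\{f\in\operatorname{Frac}(R):\delta(f)=0\}$ of $(\operatorname{Frac}(R),\delta)$ is $\mathbb C$, and (ii) the intersection of all nonzero prime differential ideals of $R$ is zero. Moreover, for every integer $n\ge 3$ such an example exists with $R$ of Krull dimension $n$.
   Context: A complex affine algebra is a finitely generated commutative $\mathbb C$-algebra that is an integral domain. The derivation $\delta$ extends uniquely to $\operatorname{Frac}(R)$ by the quotient rule. A differential ideal of $R$ is an ideal $I$ with $\delta(I)\subseteq I$. *)

(* Defs.v *)
From HB Require Import structures.
From mathcomp Require Import all_boot all_order all_algebra.
From mathcomp Require Import complex.
From mathcomp Require Import Rstruct.
Set Implicit Arguments. Unset Strict Implicit. Unset Printing Implicit Defensive.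
Import Order.TTheory GRing.Theory Num.Theory.
Local Open Scope ring_scope.

Definition CC : fieldType := (Rdefinitions.R)[i].

(* A C-algebra structure on a ring A is a ring morphism iota : C -> A;
   scalar multiplication is c . a := iota c * a. *)

Section Defs.
Variables (A : idomainType) (iota : {rmorphism CC -> A}).

Definition finitely_generated_alg : Prop :=
  exists s : seq A,
    forall S : A -> Prop,
      (forall c, S (iota c)) ->
      (forall x y, S x -> S y -> S (x + y)) ->
      (forall x y, S x -> S y -> S (x * y)) ->
      (forall x, x \in s -> S x) ->
      forall a, S a.

(* A complex affine algebra: a finitely generated C-algebra that is an
   integral domain (A : idomainType). *)
Definition complex_affine_algebra : Prop := finitely_generated_alg.

Definition is_derivation (delta : A -> A) : Prop :=
  [/\ forall x y, delta (x + y) = delta x + delta y,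
      forall x y, delta (x * y) = delta x * y + x * delta y
    & forall c x, delta (iota c * x) = iota c * delta x].

Definition is_ideal (I : A -> Prop) : Prop :=
  [/\ I 0,
      forall x y, I x -> I y -> I (x + y)
    & forall r x, I x -> I (r * x)].

Definition is_prime_ideal (I : A -> Prop) : Prop :=
  [/\ is_ideal I, ~ I 1 & forall x y, I (x * y) -> I x \/ I y].

Definition is_differential_ideal (delta : A -> A) (I : A -> Prop) : Prop :=
  is_ideal I /\ forall x, I x -> I (delta x).

Definition nonzero_ideal (I : A -> Prop) : Prop := exists x, I x /\ x <> 0.

Definition prime_chain (n : nat) : Prop :=
  exists P : nat -> A -> Prop,
    (forall i, (i <= n)%N -> is_prime_ideal (P i)) /\
    (forall i, (i < n)%N ->
       (forall x, P i x -> P i.+1 x) /\ exists x, P i.+1 x /\ ~ P i x).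

Definition krull_dim (n : nat) : Prop := prime_chain n /\ ~ prime_chain n.+1.

(* Extension of delta to Frac(A) by the quotient rule, computed on a
   representative (n, d) of the fraction f = n / d. *)
Definition frac_delta (delta : A -> A) (f : {fraction A}) : {fraction A} :=
  let nd : {ratio A} := repr f in
  FracField.tofrac (delta \n_nd * \d_nd - \n_nd * delta \d_nd)
    / FracField.tofrac (\d_nd * \d_nd).

Definition constants_are_C (delta : A -> A) : Prop :=
  forall f : {fraction A},
    frac_delta delta f = 0 <-> exists c : CC, f = FracField.tofrac (iota c).

Definition nonzero_prime_diff_ideals_meet_zero (delta : A -> A) : Prop :=
  forall a : A,
    (forall I : A -> Prop,
       is_prime_ideal I -> is_differential_ideal delta I -> nonzero_ideal I -> I a) ->
    a = 0.

End Defs.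

Definition good_example (A : idomainType) (iota : {rmorphism CC -> A})
  (delta : A -> A) : Prop :=
  [/\ complex_affine_algebra iota, is_derivation iota delta,
      constants_are_C iota delta & nonzero_prime_diff_ideals_meet_zero delta].

(* Main.v *)
Require Import Defs.
From Stdlib Require Import Classical IndefiniteDescription.
From mathcomp Require Import all_boot all_order all_algebra.
From mathcomp Require Import complex Rstruct ring zify.
Set Implicit Arguments. Unset Strict Implicit. Unset Printing Implicit Defensive.
Import GRing.Theory.
Local Open Scope ring_scope.

(** In dimension 3 take C[x,y,w], with T := x^3 - 3x - y^2 and the vector field (gX, gY, gW)
    below.  It is the canonical D-group structure on the universal vectorial extension of the
    elliptic family y^2 = x^3 - 3x - T, so it commutes with doubling, and the torsion points form
    countably many invariant curves.

    Darboux polynomials.  If delta f = c f, restrict to a nodal fibre T = -2e, e = 1 or -1.  On its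
    normalisation, with parameter r and b := w + 2r, delta is b (r^2 - 3e) d/dr.  The vanishing
    orders of f at the two points over the node determine the values of c there; since c takes equal
    values in w over the node, both orders are zero unless T + 2e divides f, and then c vanishes and
    f is constant on the fibre.  So c is divisible by T^2 - 4, but its degree in y is at most 2,
    and finally f = k (T + 2)^i (T - 2)^j.  By unique factorisation this gives the constants, and
    also that every nonzero differential ideal contains a nonzero b(x,y) free of w.

    Invariant curves.  For any point p, the polynomials f with (delta^n f)(p) = 0 for all n form a
    differential prime ideal.  It is nonzero when p is 2-torsion, since it contains y, and it stays
    nonzero under halving p, since doubling commutes with delta.  The 2-power torsion points on a
    fibre have infinitely many x-coordinates, so no b(x,y) vanishes at all of them.

    In higher dimension adjoin z with z' = b z, where b has larger degree than delta can
    produce. *)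

(** * Factorial rings *)

Section Divisibility.
Variable R : idomainType.
Implicit Types (a b c p q : R) (s t : seq R).

(** Exact divisibility: the relation [%|] on polynomials over a domain only means divisibility up to
    a nonzero scalar. *)
Definition divides a b := exists c, b = c * a.

Definition prime_elt p :=
  [/\ p != 0, p \isn't a GRing.unit &
      forall a b, divides p (a * b) -> divides p a \/ divides p b].

Definition factorial_ring :=
  forall a, a != 0 -> exists u s,
    [/\ u \is a GRing.unit, (forall p, p \in s -> prime_elt p) &
        a = u * \prod_(p <- s) p].

Lemma divides_mulr a b c : divides a b -> divides a (c * b).
Proof. by move=> [d ->]; exists (c * d); rewrite mulrA. Qed.

Lemma divides_mull a b c : divides a b -> divides a (b * c).
Proof. by rewrite mulrC; apply: divides_mulr. Qed.

Lemma divides_trans b a c : divides a b -> divides b c -> divides a c.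
Proof. by move=> [d ->] [e ->]; exists (e * d); rewrite mulrA. Qed.

Lemma dividesD a b c : divides a b -> divides a c -> divides a (b + c).
Proof. by move=> [d ->] [e ->]; exists (d + e); rewrite mulrDl. Qed.

Lemma divides0 a : divides a 0.
Proof. by exists 0; rewrite mul0r. Qed.

Lemma divides_refl a : divides a a.
Proof. by exists 1; rewrite mul1r. Qed.

Lemma divides_ideal p : is_ideal (divides p).
Proof.
by split; [apply: divides0 | move=> ? ?; apply: dividesD
  | move=> r x; apply: divides_mulr].
Qed.

Lemma divides_cancel a b c : c != 0 -> divides (c * a) (c * b) -> divides a b.
Proof.
by move=> c0 [d Ed]; exists d; apply: (mulfI c0); rewrite Ed mulrCA.
Qed.

Lemma prime_divides_unit p u : prime_elt p -> u \is a GRing.unit -> ~ divides p u.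
Proof.
move=> [_ /negP pU _] uU [c Ec]; apply: pU.
by move: uU; rewrite Ec unitrM => /andP[].
Qed.

Lemma prime_cofactor_unit p c :
  p \isn't a GRing.unit -> prime_elt (c * p) -> c \is a GRing.unit.
Proof.
move=> /negP pU [cp0 _ cpP].
have [c0 p0] : c != 0 /\ p != 0 by apply/andP; rewrite -negb_or -mulf_eq0.
case: (cpP c p (divides_refl _)) => [[d Ed]|[d Ed]].
  case: pU; apply/unitrP; exists d; rewrite mulrC; split; apply: (mulfI c0);
  by rewrite mulr1 {2}Ed; ring.
by apply/unitrP; exists d; rewrite mulrC; split; apply: (mulfI p0);
  rewrite mulr1 {2}Ed; ring.
Qed.

Lemma prime_divides_prime p q : prime_elt p -> prime_elt q -> divides p q -> divides q p.
Proof.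
move=> [_ pU _] qP [c Ec]; rewrite Ec in qP *.
have cU := prime_cofactor_unit pU qP.
by exists c^-1; rewrite mulKr.
Qed.

Lemma prime_divides_prod p u s : prime_elt p -> u \is a GRing.unit ->
  divides p (u * \prod_(q <- s) q) -> exists2 q, q \in s & divides p q.
Proof.
move=> pP uU; elim: s => [|q s IHs].
  by rewrite big_nil mulr1 => /(prime_divides_unit pP uU).
rewrite big_cons mulrCA => /(let: And3 _ _ h := pP in h) [pq|/IHs[r rs pr]].
  by exists q; rewrite ?mem_head.
by exists r; rewrite // inE rs orbT.
Qed.

Definition coprime_elts a b := forall p, prime_elt p -> divides p a -> ~ divides p b.

(** Induction on the prime factors of [a]: each of them divides [b * z] but not [b], so it can be
    cancelled from [z]. *)
Lemma coprime_dvd a b z : factorial_ring -> a != 0 -> coprime_elts a b ->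
  divides a (b * z) -> divides a z.
Proof.
move=> fR /fR[u [s [uU sP ->]]].
elim: s z sP => [|p s IHs] z sP cop abz.
  by exists (z / u); rewrite big_nil mulr1 divrK.
have pP : prime_elt p by apply: sP; rewrite mem_head.
have p0 : p != 0 by case: pP.
have pa : divides p (u * \prod_(q <- p :: s) q).
  by rewrite big_cons mulrCA; exists (u * \prod_(q <- s) q); rewrite mulrC.
have /(let: And3 _ _ h := pP in h) [pb|[z1 Ez]] := divides_trans pa abz.
  by case: (cop p pP pa).
rewrite Ez (mulrC z1) in abz *; move: abz; rewrite big_cons mulrCA (mulrCA b) => abz.
have [||d ->] := IHs z1 _ _ (divides_cancel p0 abz); last by exists d; ring.
  by move=> q qs; apply: sP; rewrite inE qs orbT.
by move=> q qP qa; apply: cop qP _; rewrite big_cons mulrCA; apply: divides_mulr.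
Qed.

(** Induction on the prime factors of [b]: a prime that divides the numerator moves into [g], any
    other stays in [b1]. *)
Lemma reduce_fraction a b : factorial_ring -> b != 0 ->
  exists g a1 b1, [/\ a = g * a1, b = g * b1 & coprime_elts a1 b1].
Proof.
move=> fR /fR[u [s [uU sP ->]]].
elim: s a sP => [|p s IHs] a sP.
  exists 1, a, u; rewrite big_nil mulr1 !mul1r; split=> // p pP _.
  exact: prime_divides_unit.
have pP : prime_elt p by apply: sP; rewrite mem_head.
have {}sP q : q \in s -> prime_elt q by move=> qs; apply: sP; rewrite inE qs orbT.
rewrite big_cons mulrCA.
have [[a' ->]|pa] := classic (divides p a).
  have [g [a1 [b1 [-> -> cop]]]] := IHs a' sP.
  by exists (p * g), a1, b1; split=> //; ring.
have [g [a1 [b1 [Ea -> cop]]]] := IHs a sP.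
exists g, a1, (p * b1); split=> //; first by ring.
move=> q qP qa1 /(let: And3 _ _ h := qP in h) [qp|]; last exact: cop qa1.
apply: pa; rewrite Ea; apply: divides_mulr.
exact: divides_trans (prime_divides_prime qP pP qp) qa1.
Qed.

End Divisibility.

(** * Gauss's lemma and polynomial rings over factorial rings *)

Section PolyFactorial.
Variable R : idomainType.
Implicit Types (c d p q : R) (F G H : {poly R}) (I : R -> Prop).

Definition poly_ideal I : {poly R} -> Prop := fun F => forall i, I F`_i.

Lemma poly_idealP I : is_ideal I -> is_ideal (poly_ideal I).
Proof.
move=> [I0 ID IM]; split=> [i|F G FI GI i|G F FI i]; rewrite ?coef0 ?coefD ?coefM //.
- exact: ID.
- by apply: (big_ind I) => // j _; apply: IM.
Qed.

(** Induction on the total size: the top coefficient of [F * G] lies in [I], so one leading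
    coefficient does, and dropping that leading term changes nothing modulo the ideal. *)
Lemma prime_poly_ideal I : is_prime_ideal I -> is_prime_ideal (poly_ideal I).
Proof.
move=> [Iid I1 IP]; have PIid := poly_idealP Iid; case: (Iid) => I0 ID IM.
have IX a n : I a -> poly_ideal I (a *: 'X^n).
  by move=> Ia i; rewrite coefZ mulrC; apply: IM.
split=> //; first by move/(_ 0); rewrite coef1.
move=> F G; have [n] := ubnP (size F + size G)%N.
elim: n F G => // n IHn F G szn FG.
have [->|F0] := eqVneq F 0; first by left => i; rewrite coef0.
have [->|G0] := eqVneq G 0; first by right => i; rewrite coef0.
(* Phrased for an arbitrary factor, with the induction hypothesis as an argument, so that both cases
   of the disjunction below are instances. *)
have step F' G' : F' != 0 -> I (lead_coef F') -> poly_ideal I (F' * G') ->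
    ((size F' + size G')%N < n.+1)%N -> 
    (forall F1, ((size F1 + size G')%N < n)%N -> poly_ideal I (F1 * G') ->
       poly_ideal I F1 \/ poly_ideal I G') -> poly_ideal I F' \/ poly_ideal I G'.
  move=> F'0 IF' FG' sz IH.
  have F'X := IX _ (size F').-1 IF'.
  have [||F1I|] := IH (F' - lead_coef F' *: 'X^((size F').-1)); last by right.
  - suff : (size (F' - lead_coef F' *: 'X^((size F').-1))%R < size F')%N by lia.
    have sF' : (size F' = (size F').-1.+1)%N by rewrite prednK // size_poly_gt0.
    rewrite sF'; apply/leq_sizeP => j; rewrite leq_eqVlt => /orP[/eqP<-|jlt].
      by rewrite coefB coefZ coefXn eqxx mulr1 subrr.
    rewrite coefB coefZ coefXn gtn_eqF // mulr0 subr0 nth_default //.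
    by rewrite sF'.
  - rewrite mulrBl; case: PIid => _ PD PM; apply: PD => //.
    by rewrite -mulNr mulrC; apply: PM => i; rewrite coefN -mulN1r; apply: IM.
  left; have -> : F' = (F' - lead_coef F' *: 'X^((size F').-1)) + lead_coef F' *: 'X^((size F').-1).
    by rewrite subrK.
  by case: PIid => _ PD _; apply: PD.
have := FG ((size F + size G).-2).
have -> : (F * G)`_((size F + size G).-2) = lead_coef F * lead_coef G.
  by rewrite -lead_coefM lead_coefE size_mul.
move=> /IP[IF|IG].
  by apply: step => // F1 szF1; apply: IHn.
suff [] : poly_ideal I G \/ poly_ideal I F by [right|left].
apply: step => //; rewrite 1?mulrC 1?addnC // => F1; rewrite mulrC addnC => szF1 h.
by case: (IHn _ _ szF1 h); [right|left].
Qed.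

Lemma divides_polyC p F : divides p%:P F <-> poly_ideal (divides p) F.
Proof.
split=> [[G -> i]|]; first by rewrite coefMC; exists G`_i.
elim/poly_ind: F => [|F c IHF] pF; first by exists 0; rewrite mul0r.
have [|G EF] := IHF; first by move=> i; have := pF i.+1; rewrite coefD coefMX coefC addr0.
have [d Ed] := pF 0; rewrite coefD coefMX coefC add0r /= in Ed.
by exists (G * 'X + d%:P); rewrite EF Ed polyCM; ring.
Qed.

(** The multiples of [p%:P] are the polynomials with all coefficients in the prime ideal [(p)], and
    these form a prime ideal. *)
Lemma prime_elt_polyC p : prime_elt p -> prime_elt p%:P.
Proof.
move=> [p0 pU pP]; split; first by rewrite polyC_eq0.
  by rewrite poly_unitE coefC /= (negPf pU) andbF.
have Ip : is_prime_ideal (divides p).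
  split=> //; first exact: divides_ideal.
  by move=> [c Ec]; case/negP: pU; apply/unitrP; exists c; rewrite [p * c]mulrC -Ec.
move=> F G /divides_polyC /(let: And3 _ _ h := prime_poly_ideal Ip in h).
by case=> /divides_polyC; [left|right].
Qed.

Definition primitive F := forall p, prime_elt p -> ~ divides p%:P F.

Hypothesis fR : factorial_ring R.

(** Gauss's lemma: the prime factors of [c] are removed one by one, each dividing the cofactor
    because it does not divide [F]. *)
Lemma primitive_dvd F G c : primitive F -> c != 0 -> divides F (c%:P * G) -> divides F G.
Proof.
move=> Fprim /fR[u [s [uU sP ->]]]; elim: s G sP => [|p s IHs] G sP.
  rewrite big_nil mulr1 => -[q Eq]; exists ((u^-1)%:P * q).
  by rewrite -mulrA -Eq mulrA -polyCM mulVr // mul1r.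
have pP : prime_elt p by apply: sP; rewrite mem_head.
have p0 : p%:P != 0 by case: (prime_elt_polyC pP).
rewrite big_cons mulrCA polyCM -mulrA => -[q Eq].
have : divides p%:P (q * F) by rewrite -Eq mulrC; exists ((u * \prod_(j <- s) j)%:P * G); rewrite mulrC.
move=> /(let: And3 _ _ h := prime_elt_polyC pP in h) [[q' Eq']|/(Fprim _ pP)//].
apply: IHs; first by move=> r rs; apply: sP; rewrite inE rs orbT.
by exists q'; apply: (mulfI p0); rewrite Eq Eq'; ring.
Qed.

(** A prime constant dividing [F] divides its leading coefficient, so only finitely many primes have
    to be extracted. *)
Lemma primitive_part F : F != 0 ->
  exists d F0, [/\ d != 0, F = d%:P * F0 & primitive F0].
Proof.
move=> F0; have /fR[u [s [uU sP Elc]]] : lead_coef F != 0 by rewrite lead_coef_eq0.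
(* [s] lists the prime factors of the leading coefficient still to be tried, [r] those known not to
   divide [F]. *)
suff: forall s r F, F != 0 -> lead_coef F = u * \prod_(p <- s ++ r) p ->
    (forall p, p \in s ++ r -> prime_elt p) ->
    (forall p, p \in r -> ~ divides p%:P F) ->
    exists d F0, [/\ d != 0, F = d%:P * F0 & primitive F0].
  by move/(_ s [::] F); rewrite cats0; apply.
move=> {F F0 s sP Elc}; elim=> [|q s IHs] r F F0 /= Elc sP rP.
  exists 1, F; rewrite oner_eq0 mul1r; split=> // p pP pF.
  have /(prime_divides_prod pP uU) [q qr pq] : divides p (u * \prod_(q <- r) q).
    by rewrite -Elc lead_coefE; move/divides_polyC: pF.
  have [c Ec] := prime_divides_prime pP (sP q qr) pq.
  apply: (rP q qr); apply: divides_trans pF; exists c%:P; by rewrite -polyCM -Ec.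
have qP : prime_elt q by apply: sP; rewrite mem_head.
have q0 : q != 0 by case: qP.
have [[F' EF]|qF] := classic (divides q%:P F).
  rewrite mulrC in EF.
  have F'0 : F' != 0 by apply: contraNneq F0; rewrite EF => ->; rewrite mulr0.
  have [||p pr|d [G [d0 EG Gprim]]] := IHs r F' F'0.
  - by move: Elc; rewrite EF lead_coefM lead_coefC big_cons mulrCA; apply: mulfI.
  - by move=> p ps; apply: sP; rewrite inE ps orbT.
  - by move=> pF'; apply: (rP p pr); rewrite EF; apply: divides_mulr.
  exists (q * d), G; split=> //; first by rewrite mulf_neq0.
  by rewrite EF EG polyCM mulrA.
apply: (IHs (q :: r) F F0).
- by rewrite Elc big_cons !big_cat big_cons /=; ring.
- by move=> p; rewrite mem_cat inE orbCA -mem_cat -in_cons; apply: sP.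
- by move=> p; rewrite inE => /orP[/eqP->|/rP].
Qed.

(** Irreducibility over the fraction field, with denominators cleared. *)
Definition irreducible_up_to_scalars F :=
  forall c G H, c != 0 -> c%:P * F = G * H -> size G = 1%N \/ size H = 1%N.

(** Over the fraction field [gcdp F G] is either trivial or all of [F]; [primitive_dvd] turns the
    resulting divisibility up to scalars into an exact one. *)
Lemma prime_elt_irreducible F : (1 < size F)%N -> primitive F ->
  irreducible_up_to_scalars F -> prime_elt F.
Proof.
move=> szF Fprim Firr; have F0 : F != 0 by rewrite -size_poly_gt0; lia.
have dvdF G : F %| G -> divides F G.
  case/Pdiv.Idomain.dvdpP => -[c q] /= c0 Ec; apply: (primitive_dvd Fprim c0).
  by exists q; rewrite -Ec mul_polyC.
split=> //; first by rewrite poly_unitE gtn_eqF.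
move=> G H [q Eq]; have FGH : F %| G * H by rewrite Eq dvdp_mulIr.
have /Pdiv.Idomain.dvdpP[[c E] /= c0 Ec] := dvdp_gcdl F G.
have [|szE|szD] := Firr c E (gcdp F G) c0; first by rewrite -Ec mul_polyC.
  left; apply: dvdF; apply: dvdp_trans (dvdp_gcdr F G).
  rewrite -(dvdpZl _ _ c0) Ec.
  have [e e0 ->] : exists2 e, e != 0 & E = e%:P by apply/size_poly1P; rewrite szE.
  by rewrite mul_polyC dvdpZl.
by right; apply: dvdF; rewrite -(Gauss_dvdpr _ (_ : coprimep F G)) // /coprimep szD.
Qed.

(** Induction on the degree. A factorisation over the fraction field descends to [R], because every
    prime of the common denominator divides one of the two factors. *)
Lemma primitive_factor n F : (size F <= n)%N -> F != 0 -> primitive F ->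
  exists (u : {poly R}) (s : seq {poly R}),
    [/\ u \is a GRing.unit, (forall q : {poly R}, q \in s -> prime_elt q) &
        F = u * \prod_(q <- s) q].
Proof.
elim: n F => [|n IHn] F szF F0 Fprim.
  by move: szF; rewrite leqn0 size_poly_eq0 (negPf F0).
have [/size1_polyC EF|szF1] := leqP (size F) 1.
  have c0 : F`_0 != 0 by rewrite -polyC_eq0 -EF.
  have [u [[|p s] [uU sP Ec]]] := fR c0.
    exists F, [::]; rewrite big_nil mulr1; split=> //.
    by rewrite EF Ec big_nil mulr1 rmorph_unit.
  case: (Fprim p (sP p (mem_head _ _))); rewrite EF Ec big_cons mulrCA polyCM.
  exact: divides_mull (divides_refl _).
have [irr|] := classic (irreducible_up_to_scalars F).
  exists 1, [:: F]; rewrite unitr1 big_seq1 mul1r; split=> // p; rewrite inE => /eqP->.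
  exact: prime_elt_irreducible.
move=> nirr; have [c [G [H [c0 EGH G1 H1]]]] :
    exists c G H, [/\ c != 0, c%:P * F = G * H, size G != 1%N & size H != 1%N].
  apply: NNPP => none; apply: nirr => c G H c0 EGH.
  have [->|G1] := eqVneq (size G) 1%N; first by left.
  have [->|H1] := eqVneq (size H) 1%N; first by right.
  by case: none; exists c, G, H.
have [u [s [uU sP Ec]]] := fR c0.
have {EGH c0} [G' [H' [EF sG sH]]] : exists G' H',
   [/\ F = G' * H', size G' = size G & size H' = size H].
  rewrite {}Ec in EGH; elim: s sP G H EGH {c0 G1 H1} => [|p s IHs] sP G H.
    rewrite big_nil mulr1 => EGH; have u0 : u != 0 by apply: contraTneq uU => ->; rewrite unitr0.
    exists (u^-1 *: G), H; rewrite size_scale ?invr_eq0 //; split=> //.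
    by rewrite -scalerAl -EGH mul_polyC scalerA mulVr // scale1r.
  have pP : prime_elt p by apply: sP; rewrite mem_head.
  have p0 : p != 0 by case: pP.
  have {}sP q : q \in s -> prime_elt q by move=> qs; apply: sP; rewrite inE qs orbT.
  rewrite big_cons mulrCA polyCM -mulrA => EGH.
  have : divides p%:P (G * H) by rewrite -EGH; apply: divides_mull (divides_refl _).
  case/(let: And3 _ _ h := prime_elt_polyC pP in h) => -[K EK].
    have [|G' [H' [E1 E2 E3]]] := IHs sP K H.
      by apply: (mulfI (_ : p%:P != 0)); rewrite ?polyC_eq0 // EGH EK; ring.
    by exists G', H'; split=> //; rewrite E2 EK mulrC mul_polyC size_scale.
  have [|G' [H' [E1 E2 E3]]] := IHs sP G K.
    by apply: (mulfI (_ : p%:P != 0)); rewrite ?polyC_eq0 // EGH EK; ring.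
  by exists G', H'; split=> //; rewrite E3 EK mulrC mul_polyC size_scale.
have [G'0 H'0] : G' != 0 /\ H' != 0 by apply/andP; rewrite -negb_or -mulf_eq0 -EF.
have szGH : (size F = (size G' + size H').-1)%N by rewrite EF size_mul.
have [szG szH] : (0 < size G' /\ 0 < size H')%N by rewrite !size_poly_gt0.
have [|//||uG [tG [uGU tGP EG]]] := IHn G'; first by lia.
  by move=> p pP pG; apply: (Fprim p pP); rewrite EF; apply: divides_mull.
have [|//||uH [tH [uHU tHP EH]]] := IHn H'; first by lia.
  by move=> p pP pH; apply: (Fprim p pP); rewrite EF; apply: divides_mulr.
exists (uG * uH), (tG ++ tH); rewrite unitrM uGU uHU; split=> //.
  by move=> p; rewrite mem_cat => /orP[/tGP|/tHP].
by rewrite EF EG EH big_cat /=; ring.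
Qed.

Lemma factorial_poly : factorial_ring {poly R}.
Proof.
move=> F nzF; have [d [F0 [d0 EF Fprim]]] := primitive_part nzF.
have F00 : F0 != 0 by apply: contraNneq nzF; rewrite EF => ->; rewrite mulr0.
rewrite {}EF {nzF}.
have [u [s [uU sP ->]]] := primitive_factor (leqnn _) F00 Fprim.
have [v [t [vU tP ->]]] := fR d0.
exists (v%:P * u), (map polyC t ++ s); split.
- by rewrite unitrM uU andbT rmorph_unit.
- move=> p; rewrite mem_cat => /orP[/mapP[q /tP qP ->]|/sP//].
  exact: prime_elt_polyC.
- by rewrite polyCM rmorph_prod big_cat big_map /=; ring.
Qed.
End PolyFactorial.

Lemma factorial_field (F : fieldType) : factorial_ring F.
Proof.
move=> a a0; exists a, [::]; rewrite big_nil mulr1 unitfE a0; split=> //.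
Qed.

(** * The vector field *)

Section Derivations.
Variables (R S : comNzRingType).

(** A derivation into [S] viewed as an [R]-module through [h]. Both sides of an intertwining
    identity such as [rho_delta] are of this kind, so it suffices to compare them on generators. *)
Definition derivation_along (h : {rmorphism R -> S}) (d : R -> S) :=
  (forall a b, d (a + b) = d a + d b) /\
  (forall a b, d (a * b) = d a * h b + h a * d b).

Section Along.
Variables (h : {rmorphism R -> S}) (d : R -> S).
Hypothesis dP : derivation_along h d.

Lemma der_add a b : d (a + b) = d a + d b. Proof. by case: dP. Qed.
Lemma der_mul a b : d (a * b) = d a * h b + h a * d b. Proof. by case: dP. Qed.
Lemma der0 : d 0 = 0.
Proof. by apply: (addrI (d 0)); rewrite -der_add !addr0. Qed.
Lemma der_opp a : d (- a) = - d a.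
Proof. by apply: (addrI (d a)); rewrite -der_add !subrr der0. Qed.
Lemma der1 : d 1 = 0.
Proof.
by apply: (addrI (d 1)); rewrite addr0 -{3}[1]mulr1 der_mul rmorph1 mulr1 mul1r.
Qed.
Lemma der_natr n : d n%:R = 0.
Proof. by elim: n => [|n IHn]; rewrite ?der0 // -natr1 der_add IHn der1 addr0. Qed.
Lemma der_exp a n : d (a ^+ n) = n%:R * h a ^+ n.-1 * d a.
Proof.
elim: n => [|n IHn]; first by rewrite der1 !mul0r.
rewrite exprS der_mul IHn rmorphXn /= -natr1; case: n {IHn} => [|n] /=; first by ring.
by rewrite [_ ^+ n.+1]exprS; ring.
Qed.
Lemma der_sum (I : Type) (r : seq I) (P : pred I) (F : I -> R) :
  d (\sum_(i <- r | P i) F i) = \sum_(i <- r | P i) d (F i).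
Proof. exact: (big_morph d der_add der0). Qed.
End Along.

Lemma derivation_along_scale h d (s : S) :
  derivation_along h d -> derivation_along h (fun a => d a * s).
Proof.
move=> [dD dM]; split=> a b; rewrite ?dD ?dM; ring.
Qed.

Lemma derivation_along_add h d1 d2 : derivation_along h d1 -> derivation_along h d2 ->
  derivation_along h (fun a => d1 a + d2 a).
Proof.
move=> [dD dM] [eD eM]; split=> a b; rewrite ?dD ?dM ?eD ?eM; ring.
Qed.
End Derivations.

Section DerivationsComp.
Variables (R S U : comNzRingType).

Lemma derivation_along_comp (h : {rmorphism R -> S}) (g : {rmorphism S -> U}) d :
  derivation_along h d -> derivation_along (g \o h) (g \o d).
Proof. by move=> [dD dM]; split=> a b; rewrite /= ?dD ?dM !(rmorphD, rmorphM). Qed.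

Lemma derivation_along_precomp (h : {rmorphism R -> S}) (g : {rmorphism S -> U}) d :
  derivation_along g d -> derivation_along (g \o h) (d \o h).
Proof.
by move=> [dD dM]; split=> a b; rewrite /= ?(rmorphD, rmorphM) ?dD ?dM.
Qed.

Lemma map_poly_derivation (d : R -> R) :
  derivation_along idfun d -> derivation_along idfun (map_poly d).
Proof.
move=> dP; have d0 := der0 dP; split=> p q; apply/polyP => i.
  by rewrite !(coefD, coef_map_id0) // (der_add dP).
rewrite coefD coef_map_id0 // !coefM (der_sum dP) -big_split /=.
by apply: eq_bigr => j _; rewrite !coef_map_id0 // (der_mul dP).
Qed.

Lemma deriv_derivation : derivation_along (idfun : {rmorphism {poly R} -> {poly R}}) (@deriv R).
Proof. by split=> p q; rewrite ?derivD ?derivM. Qed.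
End DerivationsComp.

Definition psubst (R S : comNzRingType) (h : {rmorphism R -> S}) (s : S) :
    {rmorphism {poly R} -> S} :=
  horner_morph (fun a => mulrC s (h a)).

Lemma psubstC (R S : comNzRingType) (h : {rmorphism R -> S}) s a : psubst h s a%:P = h a.
Proof. exact: horner_morphC. Qed.
Lemma psubstX (R S : comNzRingType) (h : {rmorphism R -> S}) s : psubst h s 'X = s.
Proof. exact: horner_morphX. Qed.

Lemma psubst_id (R : comNzRingType) (a : R) (p : {poly R}) : psubst idfun a p = p.[a].
Proof. by rewrite /psubst /= /horner_morph map_poly_id. Qed.
Lemma psubst_polyC (R : comNzRingType) (q p : {poly R}) : psubst polyC q p = p \Po q.
Proof. by []. Qed.

Section PolyGenerators.
Variable R : comNzRingType.
Lemma poly_generated (P : {poly R} -> Prop) :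
  (forall c, P c%:P) -> P 'X -> (forall p q, P p -> P q -> P (p + q)) ->
  (forall p q, P p -> P q -> P (p * q)) -> forall p, P p.
Proof.
move=> PC PX PD PM; elim/poly_ind => [|p c Pp]; first by rewrite -polyC0; apply: PC.
by apply: (PD _ _ (PM _ _ Pp PX)).
Qed.
End PolyGenerators.

Notation poly3 F := {poly {poly {poly F}}}.

(** * The ring in three variables and the vector field on it *)

Section ThreeVariables.
Variable F : fieldType.
Notation A := (poly3 F).

(** Locked, like the variables below, so that simplification does not unfold the nested
    polynomials. *)
Definition const3 : {rmorphism F -> A} := locked (polyC \o polyC \o polyC : {rmorphism F -> A}).
Lemma const3E c : const3 c = c%:P%:P%:P. Proof. by rewrite /const3 -lock. Qed.
Definition vx : A := locked 'X%:P%:P.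
Definition vy : A := locked 'X%:P.
Definition vw : A := locked 'X.
Lemma vxE : vx = 'X%:P%:P. Proof. by rewrite /vx -lock. Qed.
Lemma vyE : vy = 'X%:P. Proof. by rewrite /vy -lock. Qed.
Lemma vwE : vw = 'X. Proof. by rewrite /vw -lock. Qed.

Lemma poly3_generated (P : A -> Prop) :
  (forall c, P (const3 c)) -> P vx -> P vy -> P vw ->
  (forall p q, P p -> P q -> P (p + q)) ->
  (forall p q, P p -> P q -> P (p * q)) -> forall p, P p.
Proof.
rewrite vxE vyE vwE => PC Px Py Pw PD PM.
apply: poly_generated => [p||//|//]; last exact: Pw.
elim/poly_generated: p => [p||p q Pp Pq|p q Pp Pq]; last 2 first.
- by rewrite polyCD; apply: PD.
- by rewrite polyCM; apply: PM.
- elim/poly_generated: p => [c||p q Pp Pq|p q Pp Pq]; last 2 first.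
  + by rewrite !polyCD; apply: PD.
  + by rewrite !polyCM; apply: PM.
  + by rewrite -const3E; exact: PC.
  + exact: Px.
exact: Py.
Qed.

Section Subst3.
Variables (S : comNzRingType) (h : {rmorphism F -> S}).

Definition subst3 (X Y W : S) : {rmorphism A -> S} := psubst (psubst (psubst h X) Y) W.

Lemma subst3C X Y W c : subst3 X Y W (const3 c) = h c.
Proof. by rewrite const3E /subst3 /= !psubstC. Qed.
Lemma subst3x X Y W : subst3 X Y W vx = X.
Proof. by rewrite /subst3 vxE !psubstC psubstX. Qed.
Lemma subst3y X Y W : subst3 X Y W vy = Y.
Proof. by rewrite /subst3 vyE !psubstC psubstX. Qed.
Lemma subst3w X Y W : subst3 X Y W vw = W.
Proof. by rewrite /subst3 vwE psubstX. Qed.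
Definition subst3E := (subst3C, subst3x, subst3y, subst3w).
End Subst3.

Lemma rmorph3_eq (S : comNzRingType) (f g : {rmorphism A -> S}) :
  (forall c, f (const3 c) = g (const3 c)) -> f vx = g vx -> f vy = g vy -> f vw = g vw ->
  f =1 g.
Proof.
move=> fgC fgx fgy fgw; apply: poly3_generated => // p q Ep Eq.
  by rewrite !rmorphD Ep Eq.
by rewrite !rmorphM Ep Eq.
Qed.

Lemma derivation3_eq (S : comNzRingType) (h : {rmorphism A -> S}) (d e : A -> S) :
  derivation_along h d -> derivation_along h e ->
  (forall c, d (const3 c) = e (const3 c)) -> d vx = e vx -> d vy = e vy -> d vw = e vw ->
  d =1 e.
Proof.
move=> [dD dM] [eD eM] deC dex dey dew; apply: poly3_generated => // p q Ep Eq.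
  by rewrite dD eD Ep Eq.
by rewrite dM eM Ep Eq.
Qed.

(** The variables are nested with [x] innermost and [w] outermost, so each partial derivative acts
    at its own depth. *)
Definition dw : A -> A := @deriv _.
Definition dy : A -> A := map_poly (@deriv _).
Definition dx : A -> A := map_poly (map_poly (@deriv F)).

Lemma dw_der : derivation_along idfun dw. Proof. exact: deriv_derivation. Qed.
Lemma dy_der : derivation_along idfun dy.
Proof. exact/map_poly_derivation/deriv_derivation. Qed.
Lemma dx_der : derivation_along idfun dx.
Proof. exact/map_poly_derivation/map_poly_derivation/deriv_derivation. Qed.

Lemma map_polyX_der (R : comNzRingType) (d : R -> R) : derivation_along idfun d ->
  map_poly d 'X = 0.
Proof.
move=> dP; apply/polyP => i; rewrite coef_map_id0 ?(der0 dP) // coefX coef0.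
by case: (_ == _); rewrite ?(der1 dP) ?(der0 dP).
Qed.

Lemma map_polyC_der (R : comNzRingType) (d : R -> R) c : derivation_along idfun d ->
  map_poly d c%:P = (d c)%:P.
Proof.
move=> dP; apply/polyP => i; rewrite coef_map_id0 ?(der0 dP) // !coefC.
by case: (_ == _); rewrite ?(der0 dP).
Qed.

Let deF := deriv_derivation F.
Let deB := deriv_derivation {poly F}.
Lemma dwE : (forall c, dw (const3 c) = 0) * (dw vx = 0) * (dw vy = 0) * (dw vw = 1).
Proof. by split; [split; [split|]|]; rewrite /dw ?vxE ?vyE ?vwE => *; rewrite ?const3E ?derivC ?derivX. Qed.
Lemma dyE : (forall c, dy (const3 c) = 0) * (dy vx = 0) * (dy vy = 1) * (dy vw = 0).
Proof.
split; [split; [split|]|]; rewrite /dy ?vxE ?vyE ?vwE => *; rewrite ?const3E /=.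
- by rewrite (map_polyC_der _ deB) derivC.
- by rewrite (map_polyC_der _ deB) derivC.
- by rewrite (map_polyC_der _ deB) derivX.
- by rewrite (map_polyX_der deB).
Qed.
Lemma dxE : (forall c, dx (const3 c) = 0) * (dx vx = 1) * (dx vy = 0) * (dx vw = 0).
Proof.
have h := map_poly_derivation deF.
split; [split; [split|]|]; rewrite /dx ?vxE ?vyE ?vwE => *; rewrite ?const3E /=.
- by rewrite (map_polyC_der _ h) (map_polyC_der _ deF) derivC.
- by rewrite (map_polyC_der _ h) (map_polyC_der _ deF) derivX.
- by rewrite (map_polyC_der _ h) (map_polyX_der deF).
- by rewrite (map_polyX_der h).
Qed.

Section Lin3.
Variables (S : comNzRingType) (a b c : S).
Lemma lin1 : 0 * a + b = b. Proof. by ring. Qed.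
Lemma lin3_0 : 0 * a + 0 * b + 0 * c = 0. Proof. by ring. Qed.
Lemma lin3_1 : 1 * a + 0 * b + 0 * c = a. Proof. by ring. Qed.
Lemma lin3_2 : 0 * a + 1 * b + 0 * c = b. Proof. by ring. Qed.
Lemma lin3_3 : 0 * a + 0 * b + 1 * c = c. Proof. by ring. Qed.
End Lin3.

(** The field is written over an arbitrary ring so that the same formulas serve in [A], on the
    normalised nodal fibres, at points and in the fraction field. *)
Definition gT (S : comNzRingType) (x y : S) := x ^+ 3 - 3 * x - y ^+ 2.
Definition gX (S : comNzRingType) (x y w : S) := 2 * w * y + 4 * x ^+ 2 - 8 - 2 * gT x y * x.
Definition gY (S : comNzRingType) (x y w : S) :=
  3 * w * (x ^+ 2 - 1) + 6 * x * y - 3 * gT x y * y.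
Definition gW (S : comNzRingType) (x y w : S) := - 2 * w * x - 4 * y - gT x y * w.

Section RmorphG.
Variables (R S : comNzRingType) (f : {rmorphism R -> S}) (x y w : R).
Lemma rmorph_gT : f (gT x y) = gT (f x) (f y).
Proof. by rewrite /gT !(rmorph_nat, rmorphD, rmorphN, rmorphM, rmorphXn). Qed.
Lemma rmorph_gX : f (gX x y w) = gX (f x) (f y) (f w).
Proof. by rewrite /gX /gT !(rmorph_nat, rmorphD, rmorphN, rmorphM, rmorphXn). Qed.
Lemma rmorph_gY : f (gY x y w) = gY (f x) (f y) (f w).
Proof. by rewrite /gY /gT !(rmorph_nat, rmorph1, rmorphD, rmorphN, rmorphM, rmorphXn). Qed.
Lemma rmorph_gW : f (gW x y w) = gW (f x) (f y) (f w).
Proof. by rewrite /gW /gT !(rmorph_nat, rmorphD, rmorphN, rmorphM, rmorphXn). Qed.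
End RmorphG.

Lemma gT_derivation (R S : comNzRingType) (h : {rmorphism R -> S}) d x y :
  derivation_along h d ->
  d (gT x y) = 3 * (h x ^+ 2 - 1) * d x - 2 * h y * d y.
Proof.
move=> dP; rewrite /gT !(der_add dP) !(der_opp dP) !(der_exp dP) (der_mul dP).
by rewrite (der_natr dP 3) !rmorph_nat /=; ring.
Qed.

Lemma gT_identity (S : comNzRingType) (x y w : S) :
  3 * (x ^+ 2 - 1) * gX x y w - 2 * y * gY x y w = 6 * (4 - gT x y ^+ 2).
Proof. by rewrite /gX /gY /gT; ring. Qed.

Definition vT : A := gT vx vy.

Definition delta (f : A) : A := dx f * gX vx vy vw + dy f * gY vx vy vw + dw f * gW vx vy vw.

Lemma delta_der : derivation_along idfun delta.
Proof.
apply: derivation_along_add; first apply: derivation_along_add;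
  apply: derivation_along_scale.
- exact: dx_der.
- exact: dy_der.
- exact: dw_der.
Qed.

Lemma deltaE : (forall c, delta (const3 c) = 0) * (delta vx = gX vx vy vw) *
   (delta vy = gY vx vy vw) * (delta vw = gW vx vy vw).
Proof.
split; [split; [split|]|] => *; rewrite /delta ?dxE ?dyE ?dwE.
- exact: lin3_0.
- exact: lin3_1.
- exact: lin3_2.
- exact: lin3_3.
Qed.

Lemma delta_const c f : delta (const3 c * f) = const3 c * delta f.
Proof. rewrite (der_mul delta_der) deltaE; exact: lin1. Qed.

(** Hence the fibres [T = 2] and [T = -2] are invariant. They are the nodal ones, since
    [x^3 - 3x - T] has discriminant [27 (4 - T^2)]. *)
Lemma delta_T : delta vT = 6 * (4 - vT ^+ 2).
Proof.
rewrite /vT (gT_derivation _ _ delta_der) !deltaE; exact: gT_identity.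
Qed.
End ThreeVariables.
Arguments vx {F}. Arguments vy {F}. Arguments vw {F}. Arguments vT {F}. Arguments const3 {F}.

(** * Polynomials vanishing on a fibre *)

Section Vanishing.
Variable F : fieldType.
Hypothesis char0 : forall n, (n%:R == 0 :> F) = (n == 0%N).

Lemma poly_vanish (R : idomainType) (p : {poly R}) (f : nat -> R) : injective f ->
  (forall n, p.[f n] = 0) -> p = 0.
Proof.
move=> f_inj pf; apply/eqP/negPn/negP => p0.
have := @max_poly_roots _ p (map f (iota 0 (size p))) p0.
rewrite size_map size_iota ltnn => h; suff : false by []. apply: h.
  by apply/allP => x /mapP[n _ ->]; rewrite rootE pf.
by rewrite map_inj_uniq ?iota_uniq.
Qed.

Lemma natr_inj : injective (fun n => n%:R : F).
Proof.
move=> m n /eqP; wlog lemn : m n / (m <= n)%N => [h|].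
  by case/orP: (leq_total m n) => mn; [|rewrite eq_sym]; move/(h _ _ mn).
by rewrite eq_sym -subr_eq0 -natrB // char0 subn_eq0 => nm; apply/eqP; rewrite eqn_leq lemn.
Qed.

Lemma poly1_vanish (p : {poly F}) : (forall x, p.[x] = 0) -> p = 0.
Proof. by move=> h; apply: (poly_vanish natr_inj). Qed.

(** The values at all natural multiples of [t] coincide, and in characteristic zero these points are
    infinitely many. *)
Lemma poly_shift_const (p : {poly F}) t : t != 0 -> p \Po ('X + t%:P) = p -> p = (p`_0)%:P.
Proof.
move=> t0 pt; apply/eqP; rewrite -subr_eq0; apply/eqP.
apply: (@poly_vanish _ _ (fun n => n%:R * t)).
  by move=> m n /(mulIf t0)/natr_inj.
move=> n; rewrite hornerD hornerN hornerC; apply/eqP; rewrite subr_eq0; apply/eqP.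
elim: n => [|n IHn]; first by rewrite mul0r horner_coef0.
by rewrite -IHn -{2}pt horner_comp hornerD hornerX hornerC -natr1 mulrDl mul1r.
Qed.

Definition eval2 (a b : F) : {rmorphism {poly {poly F}} -> F} := psubst (psubst idfun a) b.
Definition eval3 (a b c : F) : {rmorphism poly3 F -> F} := subst3 idfun a b c.

Lemma eval2E a b p : eval2 a b p = (map_poly (psubst idfun a) p).[b].
Proof. by []. Qed.

Lemma eval2C a b p : eval2 a b p%:P = p.[a].
Proof. by rewrite /eval2 psubstC psubst_id. Qed.

Lemma eval2X a b : eval2 a b 'X = b.
Proof. exact: psubstX. Qed.

Lemma eval3E a b c p : eval3 a b c p = (map_poly (eval2 a b) p).[c].
Proof. by []. Qed.

Lemma poly2_vanish (p : {poly {poly F}}) : (forall a b, eval2 a b p = 0) -> p = 0.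
Proof.
move=> h; apply/polyP => i; rewrite coef0; apply: poly1_vanish => a.
have /polyP/(_ i) : map_poly (psubst idfun a) p = 0.
  by apply: poly1_vanish => b; rewrite -eval2E.
by rewrite coef_map coef0 /= psubst_id.
Qed.

Lemma poly3_vanish (p : poly3 F) : (forall a b c, eval3 a b c p = 0) -> p = 0.
Proof.
move=> h; apply/polyP => i; rewrite coef0; apply: poly2_vanish => a b.
have /polyP/(_ i) : map_poly (eval2 a b) p = 0.
  by apply: poly1_vanish => c; rewrite -eval3E.
by rewrite coef_map coef0.
Qed.

Hypothesis closed : forall p : {poly F}, (1 < size p)%N -> exists x, root p x.

Lemma exists_sqrt (a : F) : exists b, b ^+ 2 = a.
Proof.
have [|b] := closed (p := 'X^2 - a%:P); first by rewrite size_XnsubC.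
by rewrite rootE !hornerE subr_eq0 => /eqP Eb; exists b.
Qed.

Definition cubic T0 : {poly F} := 'X ^+ 3 - 3%:P * 'X - T0%:P.

Lemma cubicE T0 a : (cubic T0).[a] = a ^+ 3 - 3 * a - T0.
Proof. by rewrite /cubic !hornerE. Qed.

Lemma cubic_neq0 T0 : cubic T0 != 0.
Proof.
apply/eqP => /polyP/(_ 3); rewrite /cubic !coefB coefXn coefC coefCM coefX coef0 /=.
by move/eqP; rewrite mulr0 !subr0 oner_eq0.
Qed.

Definition gT2 : {poly {poly F}} := gT 'X%:P 'X.

(** Induction on the degree in [y], reducing with [y^2 = cubic T0 - (gT2 - T0)]. *)
Lemma euclid_cubic T0 (p : {poly {poly F}}) : exists q r0 r1,
  p = q * (gT2 - T0%:P%:P) + r0%:P + r1%:P * 'X.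
Proof.
elim/poly_ind: p => [|p c [q [r0 [r1 ->]]]].
  by exists 0, 0, 0; rewrite !mul0r !addr0.
exists (q * 'X - r1%:P), (r1 * cubic T0 + c), r0.
rewrite /gT2 /gT /cubic !(rmorphD, rmorphM, rmorphN, rmorphXn, rmorph_nat) /=; ring.
Qed.

Lemma divides_curve2 T0 (p : {poly {poly F}}) :
  (forall a b, gT a b = T0 -> eval2 a b p = 0) -> divides (gT2 - T0%:P%:P) p.
Proof.
move=> h; have [q [r0 [r1 Ep]]] := euclid_cubic T0 p.
have ev a b : gT a b = T0 -> r0.[a] + r1.[a] * b = 0.
  move=> Tab; have EM : eval2 a b (gT2 - T0%:P%:P) = 0.
    by rewrite rmorphB rmorph_gT !eval2C !eval2X hornerX hornerC Tab subrr.
  rewrite -[RHS](h a b Tab) {h}Ep; move: (gT2 - _) EM => M EM.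
  by rewrite !(rmorphD, rmorphM) EM mulr0 add0r !eval2C eval2X.
(* The two points [(a, b)] and [(a, -b)] of the curve separate [r0] from [r1]. *)
have r0a a : r0.[a] = 0 /\ (r1 * cubic T0).[a] = 0.
  have [b Eb] := exists_sqrt (cubic T0).[a].
  have Tb : gT a b = T0 by rewrite /gT Eb cubicE; ring.
  have Tmb : gT a (- b) = T0 by rewrite -Tb /gT; ring.
  have E1 := ev _ _ Tb; have E2 := ev _ _ Tmb.
  have n2 : (2 : F) != 0 by rewrite char0.
  have r0a : r0.[a] = 0.
    apply: (mulfI n2); rewrite mulr0 -[RHS](addr0 0) -{1}E1 -E2; ring.
  split=> //; rewrite hornerM -Eb; move: E1; rewrite r0a add0r => E1.
  by rewrite expr2 mulrA E1 mul0r.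
exists q; rewrite Ep.
have -> : r0 = 0 by apply: poly1_vanish => a; case: (r0a a).
have -> : r1 = 0.
  have : r1 * cubic T0 = 0 by apply: poly1_vanish => a; case: (r0a a).
  by move/eqP; rewrite mulf_eq0 (negPf (cubic_neq0 _)) orbF => /eqP.
by rewrite mul0r !addr0.
Qed.

Definition fibre2 (T0 : F) : {poly {poly F}} := gT2 - T0%:P%:P.
Definition fibre (T0 : F) : poly3 F := vT - const3 T0.

Lemma fibreE T0 : fibre T0 = polyC (fibre2 T0).
Proof.
by rewrite /fibre /fibre2 /vT vxE vyE const3E rmorphB rmorph_gT.
Qed.

Lemma divides_curve T0 (p : poly3 F) :
  (forall a b c, gT a b = T0 -> eval3 a b c p = 0) -> divides (fibre T0) p.
Proof.
move=> h; rewrite fibreE; apply/divides_polyC => i; apply: divides_curve2 => a b Tab.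
have /polyP/(_ i) : map_poly (eval2 a b) p = 0.
  by apply: poly1_vanish => c; rewrite -eval3E; apply: h.
by rewrite coef_map coef0.
Qed.

End Vanishing.

(** * Nodal fibres *)

Section NodalIdentities.
Variables (S : comNzRingType) (r b e : S).
Hypothesis He : e ^+ 2 = 1.
Let He3 : e ^+ 3 = e. Proof. by rewrite exprS He mulr1. Qed.
Let x := r ^+ 2 - 2 * e.
Let y := (r ^+ 2 - 3 * e) * r.
Let w := b - 2 * r.

(** [(x, y)] parametrises the cubic [T = -2 e], with the node [(e, 0)] at [r^2 = 3 e]. The three
    identities say that [delta r = b (r^2 - 3 e)] and that [b = w + 2 r] is constant along the
    field. *)
Lemma nodal_X : gX x y w = 2 * r * (b * (r ^+ 2 - 3 * e)).
Proof. rewrite /gX /gT /x /y /w; ring: He He3. Qed.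
Lemma nodal_Y : gY x y w = (3 * r ^+ 2 - 3 * e) * (b * (r ^+ 2 - 3 * e)).
Proof. rewrite /gY /gT /x /y /w; ring: He He3. Qed.
Lemma nodal_W : gW x y w = - 2 * (b * (r ^+ 2 - 3 * e)).
Proof. rewrite /gW /gT /x /y /w; ring: He He3. Qed.
End NodalIdentities.

Section Nodal.
Variable F : fieldType.
Hypothesis char0 : forall n, (n%:R == 0 :> F) = (n == 0%N).
Hypothesis closed : forall p : {poly F}, (1 < size p)%N -> exists x, root p x.
Notation G := {poly {poly F}}.

Variables e s : F.
Hypothesis He : e ^+ 2 = 1.
Hypothesis Hs : s ^+ 2 = 3 * e.

Let s_neq0 : s != 0.
Proof.
apply/eqP => s0; have /eqP : 3 * e * e = 0 :> F by rewrite -Hs s0 expr0n /= mul0r.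
by rewrite -mulrA -expr2 He mulr1 char0.
Qed.

Definition constG : {rmorphism F -> G} := polyC \o polyC.
(** [r] is the outer variable, so [deriv] is the derivative in [r] with [b] fixed, and evaluation at
    [r = t] leaves a polynomial in [b]. *)
Definition vr : G := 'X.
Definition vb : G := 'X%:P.
(* The normalisation of the fibre [T = - 2 e]. *)
Definition rho : {rmorphism poly3 F -> G} :=
  subst3 constG (vr ^+ 2 - 2 * constG e) ((vr ^+ 2 - 3 * constG e) * vr) (vb - 2 * vr).

Lemma rhoC c : rho (const3 c) = constG c. Proof. exact: subst3C. Qed.
Lemma rhox : rho vx = vr ^+ 2 - 2 * constG e. Proof. exact: subst3x. Qed.
Lemma rhoy : rho vy = (vr ^+ 2 - 3 * constG e) * vr. Proof. exact: subst3y. Qed.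
Lemma rhow : rho vw = vb - 2 * vr. Proof. exact: subst3w. Qed.

Lemma constG_deriv c : (constG c)^`() = 0. Proof. exact: derivC. Qed.

Let HeG : constG e ^+ 2 = 1. Proof. by rewrite -rmorphXn He rmorph1. Qed.

Let dG := deriv_derivation {poly F}.

Lemma rho_delta f : rho (delta f) = (rho f)^`() * (vb * (vr ^+ 2 - 3 * constG e)).
Proof.
suff E : (fun f => rho (delta f)) =1 (fun f => (rho f)^`() * (vb * (vr ^+ 2 - 3 * constG e))).
  exact: E.
apply: (@derivation3_eq F _ rho) => [||c|||].
- exact: (derivation_along_comp rho (delta_der F)).
- exact: derivation_along_scale (derivation_along_precomp rho dG).
- rewrite deltaE rhoC constG_deriv (rmorph0 rho); exact/esym/mul0r.
- rewrite deltaE rmorph_gX rhox rhoy rhow nodal_X //.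
  rewrite (der_add dG) (der_opp dG) (der_exp dG vr 2) (der_mul dG 2) (der_natr dG 2) constG_deriv.
  rewrite /vr derivX /=; ring.
- rewrite deltaE rmorph_gY rhox rhoy rhow nodal_Y //.
  rewrite (der_mul dG _ vr) (der_add dG) (der_opp dG) (der_exp dG vr 2) (der_mul dG 3) (der_natr dG 3) constG_deriv.
  rewrite /vr derivX /=; ring.
rewrite deltaE rmorph_gW rhox rhoy rhow nodal_W //.
rewrite (der_add dG) (der_opp dG) (der_mul dG 2) (der_natr dG 2).
rewrite /vr /vb derivX derivC /=; ring.
Qed.

Definition node : {rmorphism poly3 F -> {poly F}} := subst3 polyC e%:P 0 'X.

(** Both square roots [t] of [3 e] lie over the node, where [w = b - 2 t]. The values of [rho f]
    there are therefore two different shifts of the single polynomial [node f]. *)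
Lemma rho_node t f : t ^+ 2 = 3 * e ->
  (rho f).[t%:P] = node f \Po ('X - (2 * t)%:P).
Proof.
move=> Ht; have -> : (rho f).[t%:P] = (psubst idfun t%:P \o rho) f by rewrite /= psubst_id.
have -> : node f \Po ('X - (2 * t)%:P) = (psubst polyC ('X - (2 * t)%:P) \o node) f.
  by rewrite /= psubst_polyC.
have HtP : t%:P ^+ 2 = (3 * e)%:P :> {poly F} by rewrite -Ht rmorphXn.
have E3 : (3 * e)%:P = 3 * e%:P :> {poly F} by rewrite rmorphM rmorph_nat.
have Er : psubst idfun t%:P vr = t%:P by exact: psubstX.
have Eb : psubst idfun t%:P vb = 'X by exact: psubstC.
have EC c : psubst idfun t%:P (constG c) = c%:P by exact: psubstC.
move: f; apply: rmorph3_eq => [c|||].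
- by rewrite /= rhoC EC /node subst3C psubstC.
- rewrite /= rhox /node subst3x psubstC.
  by rewrite !(rmorph_nat, rmorphXn, rmorphD, rmorphN, rmorphM) Er EC HtP E3; ring.
- rewrite /= rhoy /node subst3y rmorph0.
  by rewrite !(rmorph_nat, rmorphXn, rmorphD, rmorphN, rmorphM) Er EC HtP E3; ring.
rewrite /= rhow /node subst3w psubstX.
by rewrite !(rmorph_nat, rmorphXn, rmorphD, rmorphN, rmorphM) Er Eb.
Qed.

Lemma rho_eval t c f :
  eval3 (t ^+ 2 - 2 * e) ((t ^+ 2 - 3 * e) * t) (c - 2 * t) f = (rho f).[t%:P].[c].
Proof.
have -> : (rho f).[t%:P].[c] = ((psubst idfun c \o psubst idfun t%:P) \o rho) f.
  by rewrite /= !psubst_id.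
have Er : psubst idfun c (psubst idfun t%:P vr) = t by rewrite psubstX psubstC.
have Eb : psubst idfun c (psubst idfun t%:P vb) = c by rewrite psubstC psubstX.
have EC d : psubst idfun c (psubst idfun t%:P (constG d)) = d by rewrite /= !psubstC.
move: f; apply: rmorph3_eq => [d|||].
- by rewrite /= rhoC EC /eval3 subst3C.
- rewrite /= rhox /eval3 subst3x.
  by rewrite !(rmorph_nat, rmorphXn, rmorphD, rmorphN, rmorphM) Er EC.
- rewrite /= rhoy /eval3 subst3y.
  by rewrite !(rmorph_nat, rmorphXn, rmorphD, rmorphN, rmorphM) Er EC.
rewrite /= rhow /eval3 subst3w.
by rewrite !(rmorph_nat, rmorphXn, rmorphD, rmorphN, rmorphM) Er Eb.
Qed.

(** The parametrisation reaches every point of the fibre: [r = b / (a - e)] away from the node and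
    [r = s] at it. *)
Lemma rho_eq0 f : rho f = 0 -> divides (fibre (- 2 * e)) f.
Proof.
move=> f0; apply: divides_curve => // a b c Tab.
suff [t [Ea Eb]] : exists t, a = t ^+ 2 - 2 * e /\ b = (t ^+ 2 - 3 * e) * t.
  by rewrite Ea Eb -[c](addrK (2 * t)) rho_eval f0 !horner0.
have He3 : e ^+ 3 = e by rewrite exprS He mulr1.
have Eb2 : b ^+ 2 = (a - e) ^+ 2 * (a + 2 * e).
  have : b ^+ 2 = a ^+ 3 - 3 * a - gT a b by rewrite /gT; ring.
  by rewrite Tab => ->; ring: He He3.
have [Ea|ae] := eqVneq a e.
  exists s; rewrite Hs Ea; split; first by ring.
  apply/eqP; rewrite subrr mul0r -sqrf_eq0 Eb2 Ea; apply/eqP; ring.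
have ae' : a - e != 0 by rewrite subr_eq0.
exists (b / (a - e)).
have E : (b / (a - e)) ^+ 2 = a + 2 * e.
  by rewrite expr_div_n Eb2 mulrC mulKf // expf_neq0.
rewrite E; split; first by ring.
by rewrite (_ : a + 2 * e - 3 * e = a - e); [rewrite mulrC divfK | ring].
Qed.

(* The vanishing order [i] of [f] along [r = t] can be read off its cofactor. *)
Lemma node_order t (f g : G) : t ^+ 2 = 3 * e -> f != 0 ->
  f^`() * (vb * (vr ^+ 2 - 3 * constG e)) = g * f ->
  exists i : nat, g.[t%:P] = (2 * t * i%:R) *: 'X.
Proof.
move=> Ht f0 Efg; have [i [q]] := multiplicity_XsubC f t%:P.
rewrite f0 /= => qt Ef; exists i; set z := 'X - t%:P%:P in Ef.
have z0 : z != 0 by rewrite polyXsubC_eq0.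
have Ez : vr ^+ 2 - 3 * constG e = z * (vr + constG t).
  have : constG t ^+ 2 = 3 * constG e by rewrite -rmorphXn Ht rmorphM rmorph_nat.
  by rewrite /z /vr /constG /= => <-; ring.
have zi : z * (z ^+ i)^`() = i%:R * z ^+ i.
  have dz : z^`() = 1 by rewrite /z derivB derivX derivC subr0.
  by rewrite (der_exp dG) dz /=; case: i {Ef} => [|i]; rewrite ?exprS /=; ring.
have Pz : psubst idfun t%:P z = 0 by rewrite rmorphB psubstX psubstC /= subrr.
clearbody z.
have E : (z * q^`() + i%:R * q) * (vb * (vr + constG t)) = g * q.
  apply: (mulIf (expf_neq0 i z0)); rewrite -mulrA -[g * q * _]mulrA -Ef -Efg Ez Ef derivM.
  transitivity ((q^`() * z ^+ i * z + q * (z * (z ^+ i)^`())) * (vb * (vr + constG t))).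
    by rewrite zi; ring.
  by ring.
(* At [r = t] the term with the derivative of [q] vanishes, and [q] itself does not, so it
   cancels. *)
have := congr1 (psubst idfun t%:P) E.
rewrite !(rmorph_nat, rmorphM, rmorphD) Pz.
have -> : psubst idfun t%:P vr = t%:P by exact: psubstX.
have -> : psubst idfun t%:P vb = 'X by exact: psubstC.
have -> : psubst idfun t%:P (constG t) = t%:P by exact: psubstC.
rewrite !psubst_id mul0r add0r => E'; apply: (mulIf qt); rewrite -E' -mul_polyC.
by rewrite !rmorphM !rmorph_nat; ring.
Qed.

Lemma deriv0_const (h : G) : h^`() = 0 -> h = (h`_0)%:P.
Proof.
move=> h'; apply: size1_polyC; apply/leq_sizeP => -[//|i] _.
have /eqP := coef_deriv h i; rewrite h' coef0 eq_sym -mulr_natr mulf_eq0 => /orP[/eqP//|].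
by rewrite -(rmorph_nat polyC) polyC_eq0 char0.
Qed.

Lemma nodal_darboux f c : delta f = c * f -> ~ divides (fibre (- 2 * e)) f ->
  divides (fibre (- 2 * e)) c /\
  exists k, k != 0 /\ divides (fibre (- 2 * e)) (f - const3 k).
Proof.
move=> Ecf nf; set g := rho c; set h := rho f.
have h0 : h != 0 by apply/eqP => /rho_eq0.
have Egh : h^`() * (vb * (vr ^+ 2 - 3 * constG e)) = g * h.
  by rewrite -rho_delta Ecf rmorphM.
have Hms : (- s) ^+ 2 = 3 * e by rewrite sqrrN.
have [i Ei] := node_order Hs h0 Egh; have [j Ej] := node_order Hms h0 Egh.
have n2s : 2 * s != 0 by rewrite mulf_neq0 // char0.
have Nc t (p : {poly F}) : p \Po ('X - (2 * t)%:P) \Po ('X + (2 * t)%:P) = p.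
  by rewrite -comp_polyA comp_polyB comp_polyX comp_polyC addrK comp_polyXr.
have Ni : node c = (2 * s * i%:R) *: ('X + (2 * s)%:P).
  by rewrite -[node c](Nc s) -rho_node // Ei comp_polyZ comp_polyX.
have Nj : node c = (2 * - s * j%:R) *: ('X + (2 * - s)%:P).
  by rewrite -[node c](Nc (- s)) -rho_node // Ej comp_polyZ comp_polyX.
(* The coefficients of [w] in the two expressions for [node c] give [2 s i = - 2 s j]. *)
have ij : (i + j)%N = 0%N.
  have /polyP/(_ 1%N) := Nj; rewrite Ni !coefZ !coefD !coefX !coefC /= !addr0 !mulr1.
  rewrite mulrN mulNr => /eqP; rewrite eq_sym -subr_eq0 -opprD oppr_eq0 -mulrDr -natrD.
  by rewrite mulf_eq0 (negPf n2s) /= char0 addnC => /eqP.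
have i0 : i = 0%N by lia.
have j0 : j = 0%N by lia.
have Eq : vr ^+ 2 - 3 * constG e = 'X^2 - ((3 * e)%:P)%:P.
  by rewrite /vr /constG /= !rmorphM !rmorph_nat.
have szq : size (vr ^+ 2 - 3 * constG e) = 3 by rewrite Eq size_XnsubC.
have q0 : vr ^+ 2 - 3 * constG e != 0 by rewrite -size_poly_gt0 szq.
(* [g] vanishes at [r = s] and [r = -s], but has degree at most 1 in [r], because differentiating
   [h] lowers its degree. *)
have g0 : g = 0.
  have gs : g.[s%:P] = 0 by rewrite Ei i0 mulr0 scale0r.
  have gms : g.[(- s)%:P] = 0 by rewrite Ej j0 mulr0 scale0r.
  apply/eqP/negPn/negP => gn0.
  have h'0 : h^`() != 0.
    by apply: contra_neq (_ : g * h != 0); rewrite ?mulf_neq0 // -Egh => ->; rewrite mul0r.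
  have szg : (size g <= 2)%N.
    have : size (h^`() * (vb * (vr ^+ 2 - 3 * constG e))) = size (g * h) by rewrite Egh.
    rewrite mulrCA size_Cmul ?polyX_eq0 // !size_mul // szq.
    have lth : (size h^`() < size h)%N := lt_size_deriv h0.
    by move: lth; move: (size g) (size h) (size _) => u v w; lia.
  have := @max_poly_roots _ g [:: s%:P; (- s)%:P] gn0.
  rewrite /= !rootE gs gms eqxx /= inE andbT => /(_ isT) hh.
  have : (2 < size g)%N.
    apply: hh; apply/eqP => /polyC_inj /eqP; rewrite -subr_eq0 opprK -mulr2n -mulr_natl.
    by rewrite (negPf n2s).
  by rewrite ltnNge szg.
have h'0 : h^`() = 0.
  apply/eqP; move/eqP: Egh; rewrite g0 mul0r mulf_eq0 => /orP[//|].
  by rewrite mulf_eq0 polyC_eq0 polyX_eq0 (negPf q0).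
have Eh : h = (h`_0)%:P by apply: deriv0_const.
(* [h] does not depend on [r], so the shifts of [N] by [2 s] and by [- 2 s] agree. Thus [N] has
   period [4 s] and is constant, and so is [h]. *)
set N := node f.
have Nh t : t ^+ 2 = 3 * e -> N \Po ('X - (2 * t)%:P) = h`_0.
  by move=> Ht; rewrite -rho_node // -/h Eh hornerC coefC.
have EN : N = (N`_0)%:P.
  apply: (@poly_shift_const _ char0 _ (4 * s)); first by rewrite mulf_neq0 // char0.
  rewrite -{2}(Nc s N) Nh // -(Nh (- s)) // -comp_polyA comp_polyB comp_polyX comp_polyC.
  by congr (_ \Po _); rewrite !rmorphM !rmorphN !rmorph_nat; ring.
have Eh0 : h`_0 = (N`_0)%:P by rewrite -(Nh s) // EN comp_polyC coefC.
split; first exact: rho_eq0.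
exists (N`_0); split.
  by apply: contra_neq h0 => E; rewrite Eh Eh0 E !rmorph0.
by apply: rho_eq0; rewrite rmorphB rhoC -/h Eh Eh0 subrr.
Qed.
End Nodal.

(** * Darboux polynomials *)

Section SizeBounds.
Variables (S : comNzRingType) (x w : S).

Lemma size_cubic_form (c0 c1 c2 c3 : S) :
  (size (c0%:P + c1%:P * 'X + c2%:P * 'X^2 + c3%:P * 'X^3)%R <= 4)%N.
Proof.
by apply/leq_sizeP => -[|[|[|[|j]]]] // _; rewrite !coefD !coefCM !coefXn coefX coefC /= !mulr0 !addr0.
Qed.

Lemma size_quadratic_form (c0 c1 c2 : S) :
  (size (c0%:P + c1%:P * 'X + c2%:P * 'X^2)%R <= 3)%N.
Proof.
by apply/leq_sizeP => -[|[|[|j]]] // _; rewrite !coefD !coefCM !coefXn coefX coefC /= !mulr0 !addr0.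
Qed.

Lemma size_gX : (size (gX x%:P 'X w%:P)%R <= 3)%N.
Proof.
suff -> : gX x%:P 'X w%:P = (10 * x ^+ 2 - 8 - 2 * x ^+ 4)%:P + (2 * w)%:P * 'X + (2 * x)%:P * 'X^2.
  exact: size_quadratic_form.
by rewrite /gX /gT !(rmorph_nat, rmorphXn, rmorphD, rmorphN, rmorphM); ring.
Qed.

Lemma size_gY : (size (gY x%:P 'X w%:P)%R <= 4)%N.
Proof.
suff -> : gY x%:P 'X w%:P = (3 * w * (x ^+ 2 - 1))%:P + (15 * x - 3 * x ^+ 3)%:P * 'X + 0%:P * 'X^2 + 3%:P * 'X^3.
  exact: size_cubic_form.
rewrite /gY /gT !(rmorph_nat, rmorph1, rmorphXn, rmorphD, rmorphN, rmorphM) rmorph0; ring.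
Qed.

Lemma size_gW : (size (gW x%:P 'X w%:P)%R <= 3)%N.
Proof.
suff -> : gW x%:P 'X w%:P = (w * x - w * x ^+ 3)%:P + (- 4%:R)%:P * 'X + w%:P * 'X^2.
  exact: size_quadratic_form.
by rewrite /gW /gT !(rmorph_nat, rmorphXn, rmorphD, rmorphN, rmorphM); ring.
Qed.
End SizeBounds.

Lemma rmorph_lin2 (R S : comNzRingType) (f : {rmorphism R -> S}) i j (u v : R) :
  f (i%:R * u + j%:R * v) = i%:R * f u + j%:R * f v.
Proof. by rewrite rmorphD !rmorphM !rmorph_nat. Qed.

Lemma der_monomial (S : comNzRingType) (d : S -> S) (p q : S) i j :
  derivation_along idfun d -> d p = - 6 * q * p -> d q = - 6 * p * q ->
  d (p ^+ i * q ^+ j) = - 6 * (i%:R * q + j%:R * p) * (p ^+ i * q ^+ j).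
Proof.
move=> dP dp dq; rewrite (der_mul dP) !(der_exp dP) /= dp dq.
by case: i j => [|i] [|j]; rewrite /= ?exprS; ring.
Qed.

Section YDegree.
Variable F : fieldType.
Notation A := (poly3 F).

(* [L] contains [x] and [w]; in the end it is [F[x,y,w]] itself. *)
Variables (L : idomainType) (cE : {rmorphism F -> L}) (ex ew : L).

Definition const_eta : {rmorphism F -> {poly L}} := (@polyC L) \o cE.
(** Puts [y] outermost, so that [size] measures the degree in [y]. *)
Definition eta : {rmorphism A -> {poly L}} :=
  @subst3 F {poly L} const_eta (@polyC L ex) (polyX L) (@polyC L ew).

Lemma etaC c : eta (const3 c) = (cE c)%:P. Proof. exact: subst3C. Qed.
Lemma etax : eta vx = ex%:P. Proof. exact: subst3x. Qed.
Lemma etay : eta vy = 'X. Proof. exact: subst3y. Qed.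
Lemma etaw : eta vw = ew%:P. Proof. exact: subst3w. Qed.

Lemma eta_der (dA : A -> A) (d : L -> L) : derivation_along idfun dA -> derivation_along idfun d ->
  (forall c, dA (const3 c) = 0) -> dA vy = 0 -> (forall c, d (cE c) = 0) ->
  eta (dA vx) = (d ex)%:P -> eta (dA vw) = (d ew)%:P ->
  (fun f => eta (dA f)) =1 (fun f => map_poly d (eta f)).
Proof.
move=> dAP dP dAC dAy dC dvx dvw; have mP := map_poly_derivation dP.
apply: (@derivation3_eq F _ eta) => [||c|||].
- exact: (derivation_along_comp eta dAP).
- exact: (derivation_along_precomp eta mP).
- by rewrite etaC map_polyC_der // dC dAC !rmorph0.
- by rewrite etax map_polyC_der.
- by rewrite etay map_polyX_der // dAy rmorph0.
- by rewrite etaw map_polyC_der.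
Qed.

Variables (derx derw : L -> L).
Hypotheses (derx_der : derivation_along idfun derx) (derxC : forall c, derx (cE c) = 0)
  (derxx : derx ex = 1) (derxw : derx ew = 0).
Hypotheses (derw_der : derivation_along idfun derw) (derwC : forall c, derw (cE c) = 0)
  (derwx : derw ex = 0) (derww : derw ew = 1).
Hypothesis eta_eq0 : forall f, eta f = 0 -> f = 0.

Lemma eta_dx f : eta (dx f) = map_poly derx (eta f).
Proof.
have [[[EC Ex] Ey] Ew] := dxE F.
apply: (eta_der (dx_der F) derx_der EC Ey derxC).
  by rewrite Ex derxx polyC1 (rmorph1 eta).
by rewrite Ew derxw polyC0 (rmorph0 eta).
Qed.

Lemma eta_dw f : eta (dw f) = map_poly derw (eta f).
Proof.
have [[[EC Ex] Ey] Ew] := dwE F.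
apply: (eta_der (dw_der F) derw_der EC Ey derwC).
  by rewrite Ex derwx polyC0 (rmorph0 eta).
by rewrite Ew derww polyC1 (rmorph1 eta).
Qed.

Lemma eta_dy f : eta (dy f) = (eta f)^`().
Proof.
suff Ey : (fun f => eta (dy f)) =1 (fun f => (eta f)^`()) by exact: Ey.
apply: (@derivation3_eq F _ eta) => [||c|||].
- exact: (derivation_along_comp eta (dy_der F)).
- exact: (derivation_along_precomp eta (deriv_derivation _)).
- by rewrite etaC dyE derivC rmorph0.
- by rewrite etax dyE derivC rmorph0.
- by rewrite etay dyE derivX rmorph1.
- by rewrite etaw dyE derivC rmorph0.
Qed.

(** [gX] and [gW] have degree at most 2 in [y]; [gY] has degree 3, but multiplies a derivative in
    [y], which has lost one. *)
Lemma size_eta_delta f : (size (eta (delta f)) <= size (eta f) + 2)%N.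
Proof.
have [f0|f0] := eqVneq (eta f) 0.
  by rewrite (eta_eq0 f0) (der0 (delta_der F)) rmorph0 size_poly0.
rewrite /delta 2!rmorphD !rmorphM rmorph_gX rmorph_gY rmorph_gW eta_dx eta_dy eta_dw.
rewrite etax etay etaw.
have sX := size_gX ex ew; have sY := size_gY ex ew; have sW := size_gW ex ew.
move: (gX _ _ _) (gY _ _ _) (gW _ _ _) sX sY sW => X Y W sX sY sW.
have sd : (size (eta f)^`() < size (eta f))%N := lt_size_deriv f0.
have mx : (size (map_poly derx (eta f)) <= size (eta f))%N by exact: size_poly.
have mw : (size (map_poly derw (eta f)) <= size (eta f))%N by exact: size_poly.
have n0 : (0 < size (eta f))%N by rewrite size_poly_gt0.
move: (size (eta f)) mx mw sd n0 => n.
move: (map_poly _ _) (map_poly _ _) (_^`()) => p q r mx mw sd n0.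
have bound (u v : {poly L}) k l : (size u <= k)%N -> (size v <= l)%N -> (k + l <= n + 3)%N ->
    (size (u * v)%R <= n + 2)%N.
  by move=> su sv kl; apply: leq_trans (size_polyMleq u v) _; lia.
apply: leq_trans (size_polyD _ _) _; rewrite geq_max (bound _ _ _ _ mw sW) ?leqnn // andbT.
apply: leq_trans (size_polyD _ _) _; rewrite geq_max (bound _ _ _ _ mx sX) ?leqnn //=.
by apply: (bound _ _ n.-1 4) => //; lia.
Qed.
Hypothesis char0 : forall n, (n%:R == 0 :> F) = (n == 0%N).
Hypothesis closed : forall p : {poly F}, (1 < size p)%N -> exists x, root p x.

Definition Tp : A := fibre (- 2 * 1).
Definition Tm : A := fibre (- 2 * - 1).

Lemma TpE : Tp = vT + 2.
Proof.
rewrite /Tp /fibre mulr1 rmorphN opprK; congr (_ + _); exact: rmorph_nat.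
Qed.
Lemma TmE : Tm = vT - 2.
Proof. by rewrite /Tm /fibre mulrNN mulr1; congr (_ - _); exact: rmorph_nat. Qed.

Lemma Tp_Tm : Tp = Tm + 4.
Proof. by rewrite TpE TmE; move: (vT : A) => t; ring. Qed.

Lemma delta_Tp : delta Tp = - 6 * Tm * Tp.
Proof.
rewrite TpE TmE (der_add (delta_der F)) (der_natr (delta_der F) 2) addr0 delta_T.
by move: (vT : A) => t; ring.
Qed.
Lemma delta_Tm : delta Tm = - 6 * Tp * Tm.
Proof.
rewrite TpE TmE (der_add (delta_der F)) (der_opp (delta_der F)) (der_natr (delta_der F) 2).
by rewrite oppr0 addr0 delta_T; move: (vT : A) => t; ring.
Qed.

Lemma size_eta_fibre T0 : size (eta (fibre T0 : A)) = 3.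
Proof.
have -> : eta (fibre T0 : A) = - ('X^2 - (ex ^+ 3 - 3 * ex - cE T0)%:P).
  rewrite /fibre /vT rmorphB rmorph_gT etax etay etaC /gT.
  by rewrite !(rmorph_nat, rmorphXn, rmorphD, rmorphN, rmorphM); ring.
by rewrite size_polyN size_XnsubC.
Qed.

Lemma fibre_neq0_eta T0 : (fibre T0 : A) != 0.
Proof.
by apply/eqP => E; have := size_eta_fibre T0; rewrite E rmorph0 size_poly0.
Qed.

Definition darboux_monomial k i j : A := const3 k * (Tp ^+ i * Tm ^+ j).

Lemma delta_monomial k i j :
  delta (darboux_monomial k i j) = - 6 * (i%:R * Tm + j%:R * Tp) * darboux_monomial k i j.
Proof.
rewrite /darboux_monomial delta_const (der_monomial _ _ (delta_der F) delta_Tp delta_Tm).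
by rewrite mulrCA.
Qed.

Lemma eval3_fibre a b c T0 : eval3 a b c (fibre T0) = gT a b - T0 :> F.
Proof. by rewrite /fibre /vT rmorphB rmorph_gT /eval3 !subst3E. Qed.

(** Evaluation at [(1, 0)] and [(-1, 0)], where [T] is [-2] and [2], isolates each exponent. *)
Lemma cofactor_inj i j i' j' :
  i%:R * Tm + j%:R * Tp = i'%:R * Tm + j'%:R * Tp -> i = i' /\ j = j'.
Proof.
move=> E; have ev a b := congr1 (eval3 a b 0) E.
have n4 : (4 : F) != 0 by rewrite char0.
have inj (m n : nat) : m%:R * 4 = n%:R * 4 :> F -> m = n.
  by move/(mulIf n4)/(natr_inj char0).
have ev' (a b : F) : i%:R * (gT a b - 2) + j%:R * (gT a b + 2) =
    i'%:R * (gT a b - 2) + j'%:R * (gT a b + 2).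
  have := ev a b; rewrite !(rmorph_lin2 (eval3 a b 0)) /Tp /Tm !eval3_fibre.
  by rewrite mulrNN !mulr1 opprK.
have Tp0 : gT 1 0 = - 2 :> F by rewrite /gT; ring.
have Tm0 : gT (- 1) 0 = 2 :> F by rewrite /gT; ring.
split; apply: inj.
  have := ev' 1 0; rewrite Tp0 => E1; apply: oppr_inj.
  transitivity (i%:R * (- 2 - 2) + j%:R * (- 2 + 2) : F); first by ring.
  by rewrite E1; ring.
have := ev' (- 1) 0; rewrite Tm0 => E1.
transitivity (i%:R * (2 - 2) + j%:R * (2 + 2) : F); first by ring.
by rewrite E1; ring.
Qed.

Lemma const3_cancel k : k != 0 -> const3 k^-1 * const3 k = 1 :> A.
Proof. by move=> k0; rewrite -(rmorphM const3) mulVf // (rmorph1 const3). Qed.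

(** [Tp] and [Tm] are comaximal, since their difference is the invertible constant 4. *)
Lemma divides_TpTm c : divides Tp c -> divides Tm c -> divides (Tp * Tm) c.
Proof.
move=> [c1 ->] [c2 E]; have n4 : (4 : F) != 0 by rewrite char0.
exists (const3 4^-1 * (c2 - c1)).
have E4 : const3 4^-1 * 4 = 1 :> A.
  by rewrite -[RHS](const3_cancel n4) (rmorph_nat const3 4).
have E' : c1 * 4 = (c2 - c1) * Tm by rewrite mulrBl -E Tp_Tm; ring.
transitivity (const3 4^-1 * (c1 * 4) * Tp); last by rewrite E'; ring.
by rewrite mulrCA E4 mulr1.
Qed.

(** Dividing a Darboux polynomial by [Tp] or [Tm] leaves a Darboux polynomial whose degree in [y] is
    smaller by 2, to which the induction hypothesis applies. *)
Lemma darboux_strip n (p q : A) :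
  (forall f c, (size (eta f) < n)%N -> f != 0 -> delta f = c * f ->
     exists k i j, k != 0 /\ f = darboux_monomial k i j) ->
  p != 0 -> delta p = - 6 * q * p -> size (eta p) = 3 ->
  forall f c, (size (eta (f * p)%R) < n.+1)%N -> f != 0 -> delta (f * p) = c * (f * p) ->
     exists k i j, k != 0 /\ f = darboux_monomial k i j.
Proof.
move=> IH p0 dp szp f c szf f0 df.
have ef0 : eta f != 0 by apply: contra_neq f0 => /eta_eq0.
apply: (IH f (c + 6 * q)) => //.
  have ep0 : eta p != 0 by rewrite -size_poly_gt0 szp.
  by move: szf; rewrite rmorphM size_mul // szp addn3 /=; move: (size _) => m; lia.
apply: (mulIf p0); move: df; rewrite (der_mul (delta_der F)) dp /= => Edf.
transitivity (delta f * p + f * (- 6 * q * p) + f * (6 * q * p)); first by ring.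
by rewrite Edf; ring.
Qed.

Theorem darboux_eta f c : f != 0 -> delta f = c * f ->
  exists k i j, k != 0 /\ f = darboux_monomial k i j.
Proof.
have [n] := ubnP (size (eta f)); elim: n f c => // n IHn f c szf f0 df.
have strip p q := @darboux_strip n p q IHn.
have fib0 T0 := fibre_neq0_eta T0; have szfib T0 := size_eta_fibre T0.
have [[g Ef]|np] := classic (divides Tp f).
  rewrite {}Ef in szf f0 df *; move: f0; rewrite mulf_eq0 negb_or => /andP[g0 _].
  have [k [i [j [k0 ->]]]] := strip _ _ (fib0 _) delta_Tp (szfib _) _ _ szf g0 df.
  by exists k, i.+1, j; split=> //; rewrite /darboux_monomial exprS; ring.
have [[g Ef]|nm] := classic (divides Tm f).
  rewrite {}Ef in szf f0 df *; move: f0; rewrite mulf_eq0 negb_or => /andP[g0 _].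
  have [k [i [j [k0 ->]]]] := strip _ _ (fib0 _) delta_Tm (szfib _) _ _ szf g0 df.
  by exists k, i, j.+1; split=> //; rewrite /darboux_monomial exprS; ring.
have [s Hs] := exists_sqrt closed (3 * 1 : F).
have [s' Hs'] := exists_sqrt closed (3 * - 1 : F).
have [cp [k [k0 [g Eg]]]] := nodal_darboux char0 closed (expr1n _ 2) Hs df np.
have Hm1 : (- 1 : F) ^+ 2 = 1 by rewrite sqrrN expr1n.
have [cm _] := nodal_darboux char0 closed Hm1 Hs' df nm.
(* [c] is divisible by [Tp * Tm], of degree 4 in [y], whereas [size_eta_delta] bounds its degree by
   2. *)
have c0 : c = 0.
  have [c' Ec'] := divides_TpTm cp cm; apply/eqP/negPn/negP => nzc.
  have eta0 (h : A) : h != 0 -> (0 < size (eta h))%N.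
    by move=> h0; rewrite size_poly_gt0; apply: contra_neq h0 => /eta_eq0.
  have c'0 : c' != 0 by apply: contra_neq nzc; rewrite Ec' => ->; rewrite mul0r.
  have szM (u v : A) : u != 0 -> v != 0 -> size (eta (u * v)) = (size (eta u) + size (eta v)).-1.
    by move=> u0 v0; rewrite rmorphM size_mul // -size_poly_gt0 eta0.
  have := size_eta_delta f; rewrite df szM // Ec' !szM ?mulf_neq0 ?fib0 // !szfib.
  have := eta0 _ c'0; have := eta0 _ f0.
  by move: (size (eta f)) (size (eta c')) => u v; lia.
have df0 : delta f = 0 by rewrite df c0 mul0r.
(* Now [f - k] is a first integral divisible by [Tp]. If it were nonzero, induction would make it a
   monomial with [Tp]-exponent at least 1, whose cofactor is not zero. *)
have dfk : delta (f - const3 k) = 0.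
  by rewrite (der_add (delta_der F)) (der_opp (delta_der F)) deltaE df0 oppr0 addr0.
have [g0|g0] := eqVneq g 0.
  exists k, 0%N, 0%N; split=> //; rewrite /darboux_monomial !expr0 !mulr1.
  by apply/eqP; rewrite -subr_eq0 Eg g0 mul0r.
have [k' [i [j [k'0 Eg']]]] : exists k i j, k != 0 /\ g = darboux_monomial k i j.
  apply: (strip _ _ (fib0 _) delta_Tp (szfib _) g 0) => //.
    rewrite -Eg rmorphB etaC; apply: leq_ltn_trans (size_polyD _ _) _.
    rewrite size_polyN gtn_max szf (leq_ltn_trans (size_polyC_leq1 _)) //.
    apply: leq_trans szf; rewrite ltnS size_poly_gt0.
    by apply: contra_neq f0 => /eta_eq0.
  rewrite -Eg dfk; exact/esym/mul0r.
have EgT : g * Tp = darboux_monomial k' i.+1 j.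
  by rewrite Eg' /darboux_monomial exprS; ring.
move: dfk; rewrite Eg EgT delta_monomial -EgT => /eqP.
rewrite mulf_eq0 [g * Tp == 0]mulf_eq0 (negPf g0) (negPf (fib0 _)) !orbF.
rewrite mulNr oppr_eq0 mulf_eq0 -(rmorph_nat const3 6) fmorph_eq0 char0 /= => /eqP E.
have [] // := @cofactor_inj i.+1 j 0 0.
by rewrite E; move: Tm Tp => u v; ring.
Qed.
End YDegree.

Section Darboux.
Variable F : fieldType.
Hypothesis char0 : forall n, (n%:R == 0 :> F) = (n == 0%N).
Hypothesis closed : forall p : {poly F}, (1 < size p)%N -> exists x, root p x.
Notation A := (poly3 F).

Lemma fibre_neq0 T0 : (fibre T0 : A) != 0.
Proof. exact: (@fibre_neq0_eta F A const3 vx vw). Qed.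

Lemma eta3K (f : A) : psubst idfun (vy : A) (eta const3 vx vw f) = f.
Proof.
suff K : (psubst idfun (vy : A) \o eta const3 vx vw : {rmorphism A -> A}) =1
    (idfun : {rmorphism A -> A}) by exact: K.
apply: rmorph3_eq => [c|||]; rewrite [LHS]/=.
- by rewrite etaC psubstC.
- by rewrite etax psubstC.
- by rewrite etay psubstX.
- by rewrite etaw psubstC.
Qed.

Theorem darboux (f c : A) : f != 0 -> delta f = c * f ->
  exists k i j, k != 0 /\ f = darboux_monomial k i j.
Proof.
apply: (@darboux_eta F A const3 vx vw (@dx F) (@dw F)) => //; try by move=> *; rewrite ?dxE ?dwE.
- exact: dx_der.
- exact: dw_der.
- by move=> g E; rewrite -[g]eta3K E rmorph0.
Qed.
End Darboux.

(** * Constants and elimination *)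

Section Constants.
Variable F : fieldType.
Hypothesis char0 : forall n, (n%:R == 0 :> F) = (n == 0%N).
Hypothesis closed : forall p : {poly F}, (1 < size p)%N -> exists x, root p x.
Notation A := (poly3 F).

Lemma factorial_poly2 : factorial_ring {poly {poly F}}.
Proof. exact/factorial_poly/factorial_poly/factorial_field. Qed.

Lemma factorial_poly3 : factorial_ring A.
Proof. exact/factorial_poly/factorial_poly2. Qed.

Lemma const3_eq0 k : (const3 k == 0 :> A) = (k == 0).
Proof. exact: fmorph_eq0. Qed.

(** In lowest terms, numerator and denominator each divide their own derivative. Both are then
    Darboux with the same cofactor, hence the same monomial up to a scalar. *)
Lemma delta_constants (n d : A) : d != 0 -> delta n * d = n * delta d ->
  exists k, n = const3 k * d.
Proof.
move=> d0 E; have [n0|n0] := eqVneq n 0.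
  by exists 0; rewrite n0 rmorph0 mul0r.
have [g [a [b [Ea Eb cop]]]] := reduce_fraction n factorial_poly3 d0.
have [g0 a0] : g != 0 /\ a != 0 by apply/andP; rewrite -negb_or -mulf_eq0 -Ea.
have b0 : b != 0 by apply: contra_neq d0; rewrite Eb => ->; rewrite mulr0.
have Eab : delta a * b = a * delta b.
  apply: (mulfI (mulf_neq0 g0 g0)); have dM := der_mul (delta_der F).
  move: E; rewrite {}Ea {}Eb !dM /= => E.
  transitivity ((delta g * a + g * delta a) * (g * b) - g * a * (delta g * b)); first by ring.
  by rewrite E; ring.
have [cb Ecb] : divides b (delta b).
  apply: (coprime_dvd (b := a) factorial_poly3 b0); last by exists (delta a); rewrite -Eab.
  by move=> p pP pb pa; apply: cop pP pa pb.
have [ca Eca] : divides a (delta a).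
  by apply: (coprime_dvd (b := b) factorial_poly3 a0) => //; exists (delta b); rewrite mulrC Eab mulrC.
have [ka [i [j [ka0 Ema]]]] := darboux char0 closed a0 Eca.
have [kb [i' [j' [kb0 Emb]]]] := darboux char0 closed b0 Ecb.
have n6 : - 6 != 0 :> A by rewrite oppr_eq0 -(rmorph_nat const3 6) const3_eq0 char0.
have [Ei Ej] : i = i' /\ j = j'.
  apply: (cofactor_inj char0).
  have Fa := delta_monomial ka i j; have Fb := delta_monomial kb i' j'.
  rewrite -Ema in Fa; rewrite -Emb in Fb; move: Eab; rewrite Fa Fb => E'.
  apply: (mulfI n6); apply: (mulIf a0); apply: (mulIf b0); rewrite E'; ring.
exists (ka / kb); rewrite Ea Eb Ema Emb Ei Ej /darboux_monomial (rmorphM const3).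
move: (const3 ka) (const3 kb^-1) (const3 kb) (_ * Tm F ^+ _) (const3_cancel kb0) => u v z m Evz.
transitivity (g * (u * (v * z) * m)); last by ring.
by rewrite Evz mulr1.
Qed.

Lemma minimal_size (R : nzRingType) (V : {poly R} -> Prop) : (exists f, V f /\ f <> 0) ->
  exists f, [/\ V f, f != 0 & forall g, V g -> g != 0 -> (size f <= size g)%N].
Proof.
move=> [f [Vf /eqP f0]]; have [n] := ubnP (size f).
elim: n f Vf f0 => // n IHn f Vf f0 szf.
have [[g [Vg g0 szg]]|none] := classic (exists g, [/\ V g, g != 0 & (size g < size f)%N]).
  by apply: (IHn g) => //; apply: leq_trans szg _.
exists f; split=> // g Vg g0; rewrite leqNgt; apply/negP => szg.
by apply: none; exists g.
Qed.

Lemma monomial_polyC k i j : exists m : {poly {poly F}}, darboux_monomial k i j = m%:P.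
Proof.
exists (k%:P%:P * (fibre2 (- 2 * 1) ^+ i * fibre2 (- 2 * - 1) ^+ j)).
by rewrite /darboux_monomial /Tp /Tm !fibreE const3E !polyCM !polyC_exp.
Qed.

(* The primitive part of an element of [V] of least degree in [w] generates [V] up to factors
   free of [w], so it is Darboux. *)
Lemma eliminate_w (V : A -> Prop) : is_differential_ideal (@delta F) V -> nonzero_ideal V ->
  exists b, b != 0 /\ V b%:P.
Proof.
move=> [[V0 VD VM] Vd] /minimal_size[Q [VQ Q0 Qmin]].
have [d [Q1 [d0 EQ prim]]] := primitive_part factorial_poly2 Q0.
have dP := delta_der F.
have Q10 : Q1 != 0 by apply: contra_neq Q0; rewrite EQ => ->; rewrite mulr0.
have [c Ec] : divides Q1 (delta Q1).
  (* The pseudo-remainder of [delta Q] by [Q] lies in [V] and has smaller degree in [w], so it is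
     zero. *)
  have := Pdiv.Idomain.divp_eq (delta Q) Q.
  set c := _ ^+ _; set s := _ %/ _; set r := _ %% _ => Er.
  have c0 : c != 0 by rewrite expf_neq0 // lead_coef_eq0.
  have r0 : r = 0.
    apply/eqP/negPn/negP => r0; have := ltn_modp (delta Q) Q; rewrite Q0 ltnNge => /negP; apply.
    apply: Qmin => //; rewrite -/r (_ : r = c%:P * delta Q + (- s) * Q).
      by apply: VD; apply: VM => //; apply: Vd.
    by rewrite mul_polyC Er; ring.
  apply: (primitive_dvd factorial_poly2 prim (mulf_neq0 c0 d0)).
  exists (s * d%:P - c%:P * delta d%:P).
  move: Er; rewrite r0 addr0 -mul_polyC EQ (der_mul dP) /= => Er.
  rewrite polyCM; transitivity (c%:P * (delta d%:P * Q1 + d%:P * delta Q1) - c%:P * delta d%:P * Q1).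
    by ring.
  by rewrite Er; ring.
have [k [i [j [k0 EQ1]]]] := darboux char0 closed Q10 Ec.
(* Darboux polynomials are free of [w], so [Q] is too. *)
have [m Em] := monomial_polyC k i j.
exists (d * m); rewrite polyCM -Em -EQ1 -EQ; split=> //.
by rewrite -polyC_eq0 polyCM -Em -EQ1 -EQ.
Qed.
End Constants.

(** * Jets and doubling *)

Section Jets.
Variables (R : idomainType) (d : R -> R).
Hypothesis dP : derivation_along (idfun : {rmorphism R -> R}) d.

Lemma iter_derD n a b : iter n d (a + b) = iter n d a + iter n d b.
Proof. by elim: n => //= n ->; rewrite (der_add dP). Qed.

Variables (K : fieldType) (ev : {rmorphism R -> K}).
Hypothesis char0 : forall n, (n%:R == 0 :> K) = (n == 0%N).

(* The functions vanishing along the formal integral curve of [d] through the point [ev]. *)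
Definition jet_ideal f := forall n, ev (iter n d f) = 0.

Lemma ev_iter_derM_eq0 n a b :
  (forall i, (i <= n)%N -> ev (iter i d a) = 0) -> ev (iter n d (a * b)) = 0.
Proof.
elim: n a b => [|n IHn] a b an; first by rewrite /= rmorphM (an 0%N) // mul0r.
rewrite iterSr (der_mul dP) iter_derD rmorphD IHn => [|i le]; last by rewrite -iterSr an.
by rewrite IHn ?addr0 // => i le; apply: an; lia.
Qed.

(** The one surviving term of the Leibniz formula: orders of vanishing along the integral curve add
    up. *)
Lemma ev_iter_derM_top n m a b :
  (forall i, (i < n)%N -> ev (iter i d a) = 0) ->
  (forall i, (i < m)%N -> ev (iter i d b) = 0) ->
  ev (iter (n + m) d (a * b)) = ev (iter n d a) * ev (iter m d b) *+ 'C(n + m, n).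
Proof.
have [k] := ubnP (n + m); elim: k n m a b => // k IHk [|n] [|m] a b lt an bm.
- by rewrite /= rmorphM mulr1n.
- have b' i : (i < m)%N -> ev (iter i d (d b)) = 0 by move=> im; rewrite -iterSr bm.
  have lt' : (0 + m < k)%N by move: lt; rewrite addnS ltnS.
  rewrite addnS iterSr (der_mul dP) iter_derD rmorphD [d a * b]mulrC.
  by rewrite ev_iter_derM_eq0 // add0r IHk // -iterSr !bin0.
- have a' i : (i < n)%N -> ev (iter i d (d a)) = 0 by move=> im; rewrite -iterSr an.
  have lt' : (n + 0 < k)%N by move: lt; rewrite addSn ltnS.
  rewrite addSn iterSr (der_mul dP) iter_derD rmorphD.
  by rewrite [X in _ + X]ev_iter_derM_eq0 ?addn0 // addr0 -{1}[n]addn0 IHk // -iterSr addn0 !binn.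
have a' i : (i < n)%N -> ev (iter i d (d a)) = 0 by move=> im; rewrite -iterSr an.
have b' i : (i < m)%N -> ev (iter i d (d b)) = 0 by move=> im; rewrite -iterSr bm.
have lta : (n + m.+1 < k)%N by move: lt; rewrite addSn ltnS.
have ltb : (n.+1 + m < k)%N by move: lt; rewrite addnS ltnS.
rewrite addSn iterSr (der_mul dP) iter_derD rmorphD (IHk _ _ _ _ lta a' bm).
rewrite addnS -addSn (IHk _ _ _ _ ltb an b') -!iterSr -mulrnDr.
by rewrite !addSn binS addnC.
Qed.

Lemma jet_ideal_differential : is_differential_ideal d jet_ideal.
Proof.
split; last by move=> f If n; rewrite -iterSr.
split=> [n|f g If Ig n|r f If n].
- by elim: n => [|n IHn]; rewrite ?rmorph0 // iterSr (der0 dP).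
- by rewrite iter_derD rmorphD If Ig addr0.
- by rewrite mulrC ev_iter_derM_eq0.
Qed.

(** Two elements outside the ideal have finite orders [n] and [m], and the derivative of order
    [n + m] of their product is nonzero because the binomial coefficient is nonzero in
    characteristic zero. *)
Lemma jet_ideal_prime : is_prime_ideal jet_ideal.
Proof.
have [id _] := jet_ideal_differential; split=> //.
  by move/(_ 0); rewrite /= rmorph1 => /eqP; rewrite oner_eq0.
move=> f g Ifg; have [|If] := classic (jet_ideal f); first by left.
have [|Ig] := classic (jet_ideal g); first by right.
have min h : ~ jet_ideal h -> exists n, ev (iter n d h) != 0 /\
    forall i, (i < n)%N -> ev (iter i d h) = 0.
  move=> nh; have ex : exists n, ev (iter n d h) != 0.
    by apply: NNPP => no; apply: nh => n; apply/eqP/negPn/negP => ne; apply: no; exists n.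
  exists (ex_minn ex); case: ex_minnP => n hn le; split=> // i lt.
  by apply/eqP/negPn/negP => /le; rewrite leqNgt lt.
have [n [fn fl]] := min f If; have [m [gm gl]] := min g Ig.
have := ev_iter_derM_top fl gl; rewrite Ifg => /esym/eqP.
rewrite -mulr_natr !mulf_eq0 (negPf fn) (negPf gm) char0 /= => /eqP.
by have := bin_gt0 (n + m) n; lia.
Qed.
End Jets.

Section Doubling.
Variable K : fieldType.

(* Here [w] behaves as twice the Weierstrass zeta function minus a quasi-period. *)
Definition slope (x y : K) := 3 * (x ^+ 2 - 1) / (2 * y).
(** The tangent-line formulas for doubling on [y^2 = x^3 - 3x - T]; they do not involve [T], so they
    apply to all fibres at once. *)
Definition dblx (x y : K) := slope x y ^+ 2 - 2 * x.
Definition dbly (x y : K) := slope x y * (x - dblx x y) - y.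
Definition dblw (x y w : K) := 2 * w + 2 * slope x y.

Hypothesis n2 : (2 : K) != 0.

Lemma dbl_gT x y : y != 0 -> gT (dblx x y) (dbly x y) = gT x y.
Proof.
move=> y0; rewrite /dbly /dblx /slope /gT; field; by rewrite n2 y0.
Qed.

(** Doubling is a symmetry of the vector field: the doubled coordinates satisfy the same
    differential equations. *)
Lemma dbl_derivation (d : K -> K) x y w :
  derivation_along idfun d -> y != 0 ->
  d x = gX x y w -> d y = gY x y w -> d w = gW x y w ->
  [/\ d (dblx x y) = gX (dblx x y) (dbly x y) (dblw x y w),
      d (dbly x y) = gY (dblx x y) (dbly x y) (dblw x y w) &
      d (dblw x y w) = gW (dblx x y) (dbly x y) (dblw x y w)].
Proof.
move=> dP y0 dx dy dw; have dN := der_natr dP.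
have y20 : 2 * y != 0 by rewrite mulf_neq0.
rewrite /dbly /dblw /dblx.
have E : slope x y * (2 * y) = 3 * (x ^+ 2 - 1) by rewrite divfK.
have Es : slope x y = 3 * (x ^+ 2 - 1) / (2 * y) by [].
move: (slope x y) E Es => s E Es.
(* Obtained by differentiating the relation [s * (2 * y) = 3 * (x ^+ 2 - 1)]. *)
have ds : d s = 3 * x * d x / y - s * d y / y.
  apply: (mulIf y20); have := congr1 d E.
  rewrite (der_mul dP s) (der_mul dP 2) (der_mul dP 3) !dN (der_add dP) (der_opp dP) (der_exp dP) (der1 dP) /= => E'.
  transitivity (d s * (2 * y) + s * (0 * y + 2 * d y) - 2 * (s * d y)); first by ring.
  by rewrite E'; field.
have Ex : d (s ^+ 2 - 2 * x) = 2 * s * d s - 2 * d x.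
  by rewrite (der_add dP) (der_opp dP) (der_exp dP) (der_mul dP 2) dN /=; ring.
have Ey z : d (s * (x - z) - y) = d s * (x - z) + s * (d x - d z) - d y.
  by rewrite (der_add dP) (der_opp dP) (der_mul dP s) (der_add dP) (der_opp dP).
have Ew : d (2 * w + 2 * s) = 2 * d w + 2 * d s.
  by rewrite (der_add dP) !(der_mul dP 2) dN /=; ring.
rewrite Ey Ew Ex ds dx dy dw Es /gX /gY /gW /gT.
by split; field; rewrite n2 y0.
Qed.
End Doubling.

(** * Fractions and numerators *)

Section QuotientRule.
Variables (K : fieldType) (n q m r dn dq dm dr : K).
Hypotheses (q0 : q != 0) (r0 : r != 0).

Lemma quotient_rule_add :
  ((dn * r + n * dr + (dm * q + m * dq)) * (q * r) - (n * r + m * q) * (dq * r + q * dr)) /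
    (q * r * (q * r)) = (dn * q - n * dq) / (q * q) + (dm * r - m * dr) / (r * r).
Proof. by field; rewrite q0 r0. Qed.

Lemma quotient_rule_mul :
  ((dn * m + n * dm) * (q * r) - n * m * (dq * r + q * dr)) / (q * r * (q * r)) =
  (dn * q - n * dq) / (q * q) * (m / r) + n / q * ((dm * r - m * dr) / (r * r)).
Proof. by field; rewrite q0 r0. Qed.
End QuotientRule.

Section FractionDerivation.
Variables (R : idomainType) (d : R -> R).
Hypothesis dP : derivation_along (idfun : {rmorphism R -> R}) d.
Notation tofrac := (@FracField.tofrac R).

Lemma fractionE (f : {fraction R}) : let nd : {ratio R} := repr f in
  [/\ f = tofrac \n_nd / tofrac \d_nd & \d_nd != 0].
Proof.
move=> nd; have d0 : \d_nd != 0 by exact: denom_ratioP.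
split=> //; apply: (mulIf (_ : tofrac \d_nd != 0)); first by rewrite tofrac_eq0.
rewrite divfK ?tofrac_eq0 // -[f in LHS]reprK -/nd.
rewrite /FracField.tofrac; unlock.
rewrite -[LHS]FracField.pi_mul; apply/eqP; rewrite FracField.equivf_def /FracField.mulf.
rewrite !numden_Ratio ?mulf_neq0 ?oner_eq0 //.
by rewrite !mulr1 mulrC.
Qed.

(** [frac_delta] uses a chosen representative; differentiating the cross-multiplied equality of two
    representatives shows that the choice does not matter. *)
Lemma frac_delta_div n q : q != 0 ->
  frac_delta d (tofrac n / tofrac q) = tofrac (d n * q - n * d q) / tofrac (q * q).
Proof.
move=> q0; rewrite /frac_delta; set f := tofrac n / tofrac q.
have [] := fractionE f; move: (repr f) => nd Ef d0.
have E : n * \d_nd = \n_nd * q.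
  apply/eqP; rewrite -tofrac_eq !tofracM -eqr_div ?tofrac_eq0 //; exact/eqP/Ef.
have E' := congr1 d E; rewrite !(der_mul dP) /= in E'.
have qq : tofrac (q * q) != 0 by rewrite tofrac_eq0 mulf_neq0.
have dd : tofrac (\d_nd * \d_nd) != 0 by rewrite tofrac_eq0 mulf_neq0.
have cross u v w z : u * v = w * z -> tofrac u * tofrac v = tofrac w * tofrac z.
  by move=> Euv; rewrite -[LHS]tofracM Euv tofracM.
apply/eqP; rewrite eqr_div //; apply/eqP/cross.
transitivity ((d \n_nd * q) * (\d_nd * q) - (\n_nd * q) * (d \d_nd * q)); first by ring.
have -> : d \n_nd * q = d n * \d_nd + n * d \d_nd - \n_nd * d q by rewrite E'; ring.
rewrite -E; transitivity (d n * \d_nd * \d_nd * q - (\n_nd * q) * \d_nd * d q); first by ring.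
by rewrite -E; ring.
Qed.

Lemma frac_delta_tofrac a : frac_delta d (tofrac a) = tofrac (d a).
Proof.
have := frac_delta_div a (oner_neq0 R).
by rewrite (der1 dP) !mulr1 mulr0 subr0 rmorph1 !divr1.
Qed.

Lemma frac_delta_derivation : derivation_along idfun (frac_delta d).
Proof.
split=> f g; have [Ef f0] := fractionE f; have [Eg g0] := fractionE g; move: Ef Eg f0 g0;
  move: (repr f) (repr g) => [[n q] /= _] [[m r] /= _] -> -> q0 r0.
all: have qF : tofrac q != 0 by rewrite tofrac_eq0.
all: have rF : tofrac r != 0 by rewrite tofrac_eq0.
  rewrite addf_div // -!tofracM -tofracD !frac_delta_div ?mulf_neq0 // (der_add dP) !(der_mul dP) /=.
  by rewrite !(tofracB, tofracD, tofracM) quotient_rule_add.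
rewrite mulf_div -!tofracM !frac_delta_div ?mulf_neq0 // !(der_mul dP) /=.
by rewrite !(tofracB, tofracD, tofracM) quotient_rule_mul.
Qed.

Lemma frac_delta_eq0 n q : q != 0 ->
  frac_delta d (tofrac n / tofrac q) = 0 <-> d n * q = n * d q.
Proof.
move=> q0; rewrite frac_delta_div //; split=> [/eqP|->]; last by rewrite subrr rmorph0 mul0r.
rewrite mulf_eq0 invr_eq0 !tofrac_eq0 mulf_eq0 (negPf q0) !orbF subr_eq0.
by move/eqP.
Qed.
End FractionDerivation.

Section NumeratorForms.
Variables (R S : comNzRingType) (h : {rmorphism R -> S}) (x y w c : R).

(* Here [c] stands for [1/2]. *)
Definition numx (R : comNzRingType) (x y c : R) :=
  (3 * (x ^+ 2 - 1) * c) ^+ 2 - 2 * x * y ^+ 2.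
Definition numy (R : comNzRingType) (x y c : R) :=
  (3 * (x ^+ 2 - 1) * c) * (3 * x * y ^+ 2 - (3 * (x ^+ 2 - 1) * c) ^+ 2) - y ^+ 4.
Definition numw (R : comNzRingType) (x y w : R) := 2 * w * y + 3 * (x ^+ 2 - 1).

Lemma rmorph_numx : h (numx x y c) = numx (h x) (h y) (h c).
Proof. by rewrite /numx !(rmorph_nat, rmorph1, rmorphXn, rmorphD, rmorphN, rmorphM). Qed.
Lemma rmorph_numy : h (numy x y c) = numy (h x) (h y) (h c).
Proof. by rewrite /numy !(rmorph_nat, rmorph1, rmorphXn, rmorphD, rmorphN, rmorphM). Qed.
Lemma rmorph_numw : h (numw x y w) = numw (h x) (h y) (h w).
Proof. by rewrite /numw !(rmorph_nat, rmorph1, rmorphXn, rmorphD, rmorphN, rmorphM). Qed.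
End NumeratorForms.

Section Numerators.
Variable F : fieldType.
Hypothesis char0 : forall n, (n%:R == 0 :> F) = (n == 0%N).
Notation A := (poly3 F).

Definition dbl_hom (K : fieldType) (h : {rmorphism A -> K}) : {rmorphism A -> K} :=
  @subst3 F K (h \o @const3 F) (dblx (h vx) (h vy)) (dbly (h vx) (h vy)) (dblw (h vx) (h vy) (h vw)).

Lemma dbl_homC (K : fieldType) (h : {rmorphism A -> K}) c : dbl_hom h (const3 c) = h (const3 c).
Proof. exact: subst3C. Qed.

(** Doubling is only rational, with poles along [y = 0]. Quantifying over all field-valued points
    lets one [g] serve both at points over [F] and at the generic point. *)
Definition numerator N (f g : A) := forall (K : fieldType) (h : {rmorphism A -> K}),
  (2 : K) != 0 -> h vy != 0 -> h g = h vy ^+ N * dbl_hom h f.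

Lemma numerator_exists f : exists N g, numerator N f g.
Proof.
have half (K : fieldType) (h : {rmorphism A -> K}) : (2 : K) != 0 -> h (const3 2^-1) = 2^-1.
  move=> n2; apply: (mulfI n2); rewrite mulfV // -(rmorph_nat h 2) -(rmorph_nat const3 2) -!rmorphM.
  by rewrite mulfV ?char0 // !rmorph1.
pose c2 : A := const3 2^-1.
elim/poly3_generated: f => [c||||f g [N [nf Hf]] [M [ng Hg]]|f g [N [nf Hf]] [M [ng Hg]]].
- by exists 0%N, (const3 c) => K h _ _; rewrite dbl_homC expr0 mul1r.
- exists 2, (numx vx vy c2) => K h n2 y0.
  rewrite /dbl_hom subst3x rmorph_numx half //.
  by move: (h vx) (h vy) y0 => x y y0; rewrite /numx /dblx /slope; field; rewrite n2 y0.
- exists 3, (numy vx vy c2) => K h n2 y0.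
  rewrite /dbl_hom subst3y rmorph_numy half //.
  by move: (h vx) (h vy) y0 => x y y0; rewrite /numy /dbly /dblx /slope; field; rewrite n2 y0.
- exists 1%N, (numw vx vy vw) => K h n2 y0.
  rewrite /dbl_hom subst3w rmorph_numw.
  by move: (h vx) (h vy) (h vw) y0 => x y w y0; rewrite /numw /dblw /slope; field; rewrite n2 y0.
- exists (N + M)%N, (nf * vy ^+ M + ng * vy ^+ N) => K h n2 y0.
  by rewrite rmorphD !rmorphM !rmorphXn Hf // Hg // rmorphD exprD; ring.
- exists (N + M)%N, (nf * ng) => K h n2 y0.
  by rewrite !rmorphM Hf // Hg // exprD; ring.
Qed.
End Numerators.

(** * Torsion curves *)

Section LinearForms.
Variable S : comNzRingType.
(** [gY] and [gW] lie in the ideal [(y, w)], so the curve [y = w = 0] of 2-torsion points is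
    invariant; these are the coefficients of the derivative of [u y + v w]. *)
Definition next_u (x t du u v : S) := du + u * (6 * x - 3 * t) - 4 * v.
Definition next_v (x t dv u v : S) := dv + u * (3 * (x ^+ 2 - 1)) - v * (2 * x + t).

Lemma next_uvE (x y w u v du dv : S) :
  du * y + u * gY x y w + (dv * w + v * gW x y w) =
  next_u x (gT x y) du u v * y + next_v x (gT x y) dv u v * w.
Proof. by rewrite /next_u /next_v /gY /gW; move: (gT x y) => t; ring. Qed.

Lemma lin_first (y w : S) : y = 1 * y + 0 * w. Proof. by ring. Qed.
End LinearForms.

Section Transport.
Variable F : fieldType.
Hypothesis char0 : forall n, (n%:R == 0 :> F) = (n == 0%N).
Notation A := (poly3 F).
Variables (L : fieldType) (io : {rmorphism A -> L}) (dL : L -> L).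
Hypothesis io_inj : injective io.
Hypothesis dLP : derivation_along (idfun : {rmorphism L -> L}) dL.
Hypothesis dL_io : forall f, dL (io f) = io (delta f).
Hypothesis n2L : (2 : L) != 0.
Hypothesis y0L : io vy != 0.

Notation sigma := (dbl_hom io).

Lemma sigma_delta f : dL (sigma f) = sigma (delta f).
Proof.
have [Dx Dy Dw] : [/\ dL (sigma vx) = gX (sigma vx) (sigma vy) (sigma vw),
   dL (sigma vy) = gY (sigma vx) (sigma vy) (sigma vw) &
   dL (sigma vw) = gW (sigma vx) (sigma vy) (sigma vw)].
  rewrite /dbl_hom subst3x subst3y subst3w.
  by apply: (dbl_derivation n2L dLP y0L); rewrite dL_io deltaE ?rmorph_gX ?rmorph_gY ?rmorph_gW.
suff E : (fun f => dL (sigma f)) =1 (fun f => sigma (delta f)) by exact: E.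
apply: (@derivation3_eq F _ sigma) => [||c|||].
- exact: (derivation_along_precomp sigma dLP).
- exact: (derivation_along_comp sigma (delta_der F)).
- by rewrite dbl_homC dL_io deltaE !rmorph0.
- rewrite Dx deltaE; exact/esym/(rmorph_gX sigma).
- rewrite Dy deltaE; exact/esym/(rmorph_gY sigma).
- rewrite Dw deltaE; exact/esym/(rmorph_gW sigma).
Qed.

Variable h : {rmorphism A -> F}.
Hypothesis hy0 : h vy != 0.

(** Pulls an equation of the curve through the doubled point back to the curve through the point
    [h]. The induction is on the order of the derivative; the powers of [y] that appear do not
    vanish at [h]. *)
Lemma transport_jet_along f N g : jet_ideal (@delta F) (dbl_hom h) f ->
  io g = io vy ^+ N * sigma f -> jet_ideal (@delta F) h g.
Proof.
move=> If Eg n; have [k] := ubnP n; elim: k n f N g If Eg => // k IHk [|n] f N g If Eg ltnk.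
  (* In order zero, [g] agrees up to powers of [y] with a numerator of [f], which can be evaluated
     at [h]. *)
  have [N0 [g0 Hg0]] := numerator_exists char0 f.
  have n2 : (2 : F) != 0 by rewrite char0.
  have E : g * vy ^+ N0 = g0 * vy ^+ N.
    by apply: io_inj; rewrite !rmorphM !rmorphXn Eg (Hg0 _ io) //; ring.
  have := congr1 h E; rewrite !rmorphM !rmorphXn (Hg0 _ h) // (If 0%N) mulr0 mul0r.
  by move/eqP; rewrite mulf_eq0 expf_eq0 (negPf hy0) andbF orbF => /eqP.
(* [g'] is the numerator belonging to [delta f], with one more power of [y]; it yields the next
   derivative of [g] from lower ones. *)
pose g' := vy * delta g - N%:R * delta vy * g.
have Eg' : io g' = io vy ^+ N.+1 * sigma (delta f).
  rewrite -sigma_delta /g' rmorphB !rmorphM rmorph_nat -!dL_io Eg (der_mul dLP) (der_exp dLP) /=.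
  case: N {Eg g'} => [|N]; rewrite ?exprS /=; ring.
have If' : jet_ideal (@delta F) (dbl_hom h) (delta f) by move=> m; rewrite -iterSr If.
have ltn : (n < k)%N by rewrite ltnS in ltnk.
have Z1 := IHk n _ _ _ If' Eg' ltn.
have Z2 i : (i <= n)%N -> h (iter i (@delta F) g) = 0.
  by move=> le; apply: (IHk i _ _ _ If Eg); apply: leq_ltn_trans le ltn.
have dP := delta_der F.
have top : h (iter n (@delta F) (vy * delta g)) = h vy * h (iter n (@delta F) (delta g)).
  have := @ev_iter_derM_top _ _ dP _ h 0 n vy (delta g).
  by rewrite add0n bin0 mulr1n; apply => // i lti; rewrite -iterSr Z2.
have Eyg : vy * delta g = g' + N%:R * delta vy * g by rewrite /g' subrK.
apply: (mulfI hy0); rewrite mulr0 iterSr -top Eyg (iter_derD dP) rmorphD Z1 add0r.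
by rewrite mulrC (ev_iter_derM_eq0 dP).
Qed.
End Transport.

Section TransportFraction.
Variable F : fieldType.
Hypothesis char0 : forall n, (n%:R == 0 :> F) = (n == 0%N).
Notation A := (poly3 F).
Definition frac_field : fieldType := {fraction A}.
Definition to_frac : {rmorphism A -> frac_field} := @FracField.tofrac A.
Definition frac_der : frac_field -> frac_field := frac_delta (@delta F).

Lemma to_frac_eq0 a : (to_frac a == 0) = (a == 0). Proof. exact: tofrac_eq0. Qed.
Lemma to_frac_inj : injective to_frac.
Proof.
by move=> a b E; apply/eqP; rewrite -subr_eq0 -to_frac_eq0 rmorphB E subrr.
Qed.
Lemma frac_der_derivation : derivation_along (idfun : {rmorphism frac_field -> frac_field}) frac_der.
Proof. exact: (frac_delta_derivation (delta_der F)). Qed.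
Lemma frac_der_to_frac f : frac_der (to_frac f) = to_frac (delta f).
Proof. exact: (frac_delta_tofrac (delta_der F)). Qed.
Lemma vy_neq0 : vy != 0 :> A.
Proof.
apply/eqP => E; have := congr1 (eval3 0 1 0) E.
by rewrite (rmorph0 (eval3 0 1 0)) /eval3 subst3y => /eqP; rewrite oner_eq0.
Qed.
Lemma frac_two_neq0 : (2 : frac_field) != 0.
Proof. by rewrite -(rmorph_nat to_frac 2) to_frac_eq0 -(rmorph_nat const3 2) fmorph_eq0 char0. Qed.
Lemma to_frac_vy : to_frac vy != 0. Proof. by rewrite to_frac_eq0 vy_neq0. Qed.

Lemma transport_jet (h : {rmorphism A -> F}) (f g : A) N : h vy != 0 ->
  jet_ideal (@delta F) (dbl_hom h) f -> numerator N f g -> jet_ideal (@delta F) h g.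
Proof.
move=> hy0 If Hg.
exact: (@transport_jet_along F char0 frac_field to_frac frac_der to_frac_inj
  frac_der_derivation frac_der_to_frac frac_two_neq0 to_frac_vy h hy0 f N g If
  (Hg frac_field to_frac frac_two_neq0 to_frac_vy)).
Qed.
End TransportFraction.

(** * Halving and points of 2-power order *)

Section Torsion.
Variable F : fieldType.
Hypothesis char0 : forall n, (n%:R == 0 :> F) = (n == 0%N).
Hypothesis closed : forall p : {poly F}, (1 < size p)%N -> exists x, root p x.
Notation A := (poly3 F).
Let n2 : (2 : F) != 0. Proof. by rewrite char0. Qed.

(** Doubling is onto on every smooth fibre, including the [w]-coordinate, for which the equation is
    linear. *)
Lemma halving (a b c T0 : F) : gT a b = T0 -> T0 ^+ 2 != 4 -> exists a' b' c',
  [/\ b' != 0, gT a' b' = T0, dblx a' b' = a, dbly a' b' = b & dblw a' b' c' = c].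
Proof.
move=> Tab T4.
(* [dblx u v = a] with the denominator [4 v^2] cleared and [v^2 = u^3 - 3u - T0] substituted. *)
pose Q : {poly F} := 'X^4 + ((9 + 4 * a * T0)%:P + (12 * a + 8 * T0)%:P * 'X + 6%:P * 'X^2 + (- (4 * a))%:P * 'X^3).
have szQ : size Q = 5.
  by rewrite size_polyDl size_polyXn // ltnS size_cubic_form.
have [|u] := closed (p := Q); first by rewrite szQ.
rewrite /root /Q !(hornerC, hornerXn, hornerX, hornerM, hornerD) => /eqP Qu.
have {Qu} Eu : 9 * (u ^+ 2 - 1) ^+ 2 = 4 * (a + 2 * u) * (u ^+ 3 - 3 * u - T0).
   apply/eqP; rewrite -subr_eq0 -Qu; apply/eqP; ring.
(* Otherwise [u^2 = 1] and [u] is a double root of the cubic, which happens only on the nodal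
   fibres. *)
have Fu0 : u ^+ 3 - 3 * u - T0 != 0.
  apply: contra T4 => /eqP Fu; have n9 : (9 : F) != 0 by rewrite char0.
  have u1 : u ^+ 2 = 1.
    apply/eqP; rewrite -subr_eq0 -sqrf_eq0 -(inj_eq (mulfI n9)) mulr0 Eu Fu mulr0 //.
  have u3 : u ^+ 3 = u by rewrite exprS u1 mulr1.
  have -> : T0 = - 2 * u.
    by move: Fu; rewrite u3 => Fu; apply/eqP; rewrite -subr_eq0 -oppr_eq0 -Fu; apply/eqP; ring.
  by apply/eqP; transitivity (4 * u ^+ 2); [ring | rewrite u1 mulr1].
have [v Ev] := exists_sqrt closed (u ^+ 3 - 3 * u - T0).
have v0 : v != 0 by apply: contra_neq Fu0 => v0; rewrite -Ev v0 expr0n.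
have sl w : w ^+ 2 = u ^+ 3 - 3 * u - T0 -> dblx u w = a.
  move=> Ew; have w20 : 4 * w ^+ 2 != 0 by rewrite mulf_neq0 ?char0 // Ew.
  rewrite /dblx /slope expr_div_n !exprMn; apply/eqP; rewrite subr_eq; apply/eqP.
  have -> : (2 : F) ^+ 2 = 4 by ring.
  have -> : (3 : F) ^+ 2 = 9 by ring.
  rewrite Eu -Ew (_ : 4 * _ * _ = (a + 2 * u) * (4 * w ^+ 2)); last by ring.
  by rewrite mulfK.
have gTw w : w ^+ 2 = u ^+ 3 - 3 * u - T0 -> gT u w = T0 by move=> Ew; rewrite /gT Ew; ring.
(* Doubling preserves [gT], which fixes [dbly u v] up to sign; changing the sign of [v] corrects
   it. *)
have [w [Ew w0 Ew2]] : exists w, [/\ w ^+ 2 = u ^+ 3 - 3 * u - T0, w != 0 & dbly u w = b].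
  have : dbly u v ^+ 2 == b ^+ 2.
    have := dbl_gT n2 u v0; rewrite gTw // sl // -Tab /gT => /eqP.
    by rewrite (inj_eq (addrI _)) (inj_eq oppr_inj).
  rewrite eqf_sqr => /orP[/eqP E|/eqP E]; first by exists v.
  exists (- v); rewrite sqrrN oppr_eq0; split=> //; rewrite -[b]opprK -E.
  have slN : slope u (- v) = - slope u v by rewrite /slope mulrN invrN mulrN.
  by rewrite /dbly /dblx slN sqrrN; ring.
exists u, w, ((c - 2 * slope u w) / 2); split=> //; [exact: gTw | exact: sl |].
by rewrite /dblw mulrC divfK // subrK.
Qed.

(** Points that reach a 2-torsion point with [w = 0] after [k] doublings; on a smooth fibre [(a, b)]
    has order [2^(k+1)]. The condition [b != 0] keeps each doubling defined. *)
Fixpoint torsion (T0 : F) k a b c : Prop :=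
  if k is k'.+1 then
    [/\ b != 0, gT a b = T0 & torsion T0 k' (dblx a b) (dbly a b) (dblw a b c)]
  else [/\ b = 0, c = 0 & gT a 0 = T0].

Lemma torsion_gT T0 k a b c : torsion T0 k a b c -> gT a b = T0.
Proof. by case: k => [[-> _ ->]|k []]. Qed.

Lemma size_cubic (T0 : F) : size (cubic T0) = 4.
Proof.
have -> : cubic T0 = 'X^3 + ((- T0)%:P + (- 3)%:P * 'X + 0%:P * 'X^2).
  by rewrite /cubic !rmorphN rmorph0; ring.
by rewrite size_polyDl size_polyXn // ltnS size_quadratic_form.
Qed.

Lemma torsion_exists T0 k : T0 ^+ 2 != 4 -> exists a b c, torsion T0 k a b c.
Proof.
move=> T4; elim: k => [|k [a [b [c tabc]]]].
  have [|a] := closed (p := cubic T0); first by rewrite size_cubic.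
  rewrite rootE cubicE => /eqP Ea; exists a, 0, 0; split=> //.
  by rewrite /gT; transitivity (T0 + (a ^+ 3 - 3 * a - T0)); [ring | rewrite Ea addr0].
have [a' [b' [c' [b'0 Ta' Ex Ey Ew]]]] := halving c (torsion_gT tabc) T4.
by exists a', b', c'; rewrite /= Ex Ey Ew.
Qed.

(** On a fibre, [a] determines [b] up to sign and hence the abscissa of the double. Points of
    different levels thus have different abscissas, so there are infinitely many of these. *)
Lemma torsion_level T0 i j a b c b' c' :
  torsion T0 i a b c -> torsion T0 j a b' c' -> i = j.
Proof.
have zero (x y : F) : gT x y = gT x 0 -> y = 0.
  rewrite /gT expr0n /= => /(addrI _)/oppr_inj/eqP.
  by rewrite expf_eq0 => /eqP.
elim: i j a b c b' c' => [|i IHi] [|j] a b c b' c' //=.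
- by move=> [_ _ Ta] [b'0 Tb' _]; case/eqP: b'0; apply: (zero a); rewrite Ta.
- by move=> [b0 Tb _] [_ _ Ta]; case/eqP: b0; apply: (zero a); rewrite Ta.
move=> [b0 Tb tb] [b'0 Tb' tb']; congr _.+1.
have E : dblx a b = dblx a b'.
  have : b ^+ 2 = b' ^+ 2 by apply: oppr_inj; apply: (addrI (a ^+ 3 - 3 * a)); rewrite -/(gT a b) Tb -Tb'.
  by rewrite /dblx /slope !expr_div_n !exprMn => ->.
by apply: IHi tb _; rewrite E; exact: tb'.
Qed.

Lemma torsion_list T0 k : T0 ^+ 2 != 4 -> exists s : seq F, [/\ uniq s, size s = k &
  forall a, a \in s -> exists i b c, (i < k)%N /\ torsion T0 i a b c].
Proof.
move=> T4; elim: k => [|k [s [us szs Hs]]]; first by exists [::].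
have [a [b [c tabc]]] := torsion_exists k T4.
exists (a :: s); rewrite /= us szs andbT; split=> //.
  apply/negP => /Hs[i [b' [c' [lt t']]]]; have := torsion_level tabc t'; lia.
move=> x; rewrite inE => /orP[/eqP->|/Hs[i [b' [c' [lt t']]]]]; first by exists k, b, c.
by exists i, b', c'; split=> //; lia.
Qed.

(** Modulo the curve, [p] is [r0 + r1 y]. Vanishing at a torsion point gives [r0^2 = r1^2 cubic], an
    equation in [x] alone that holds at infinitely many abscissas. *)
Lemma vanish_on_torsion T0 (p : {poly {poly F}}) : T0 ^+ 2 != 4 ->
  (forall k a b c, torsion T0 k a b c -> eval2 a b p = 0) -> exists q, p = q * fibre2 T0.
Proof.
move=> T4 Hp; have [q [r0 [r1 Ep]]] := euclid_cubic T0 p; exists q.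
have ev k a b c : torsion T0 k a b c -> r0.[a] ^+ 2 = r1.[a] ^+ 2 * (cubic T0).[a].
  move=> t; have Tab := torsion_gT t.
  have EM : eval2 a b (gT2 F - T0%:P%:P) = 0.
    by rewrite rmorphB rmorph_gT !eval2C !eval2X hornerX hornerC Tab subrr.
  have := Hp _ _ _ _ t; rewrite {}Ep; move: (gT2 F - _) EM => M EM.
  rewrite !(rmorphD, rmorphM) EM mulr0 add0r !eval2C eval2X => /eqP.
  rewrite addr_eq0 => /eqP ->; rewrite sqrrN exprMn cubicE; congr (_ * _).
  by rewrite -Tab /gT; ring.
have E : r0 ^+ 2 = r1 ^+ 2 * cubic T0.
  apply/eqP; rewrite -subr_eq0; apply/negPn/negP => nz.
  have [s [us szs Hs]] := torsion_list (size (r0 ^+ 2 - r1 ^+ 2 * cubic T0)) T4.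
  have := max_poly_roots nz _ us; rewrite szs ltnn => h; suff : false by []; apply: h.
  apply/allP => x /Hs[i [b [c [_ t]]]].
  by rewrite rootE hornerD hornerN horner_exp hornerM horner_exp (ev _ _ _ _ t) subrr.
have c0 : cubic T0 != 0 by rewrite -size_poly_gt0 size_cubic.
(* A nonzero [r0^2] has even degree, a nonzero [r1^2 * cubic T0] odd degree. *)
have r10 : r1 = 0.
  apply/eqP/negPn/negP => r1n; have r0n : r0 != 0.
    by rewrite -sqrf_eq0 E mulf_neq0 // sqrf_eq0.
  have : size (r0 * r0) = size (r1 * r1 * cubic T0) by rewrite -!expr2 E.
  rewrite !size_mul ?mulf_neq0 // size_cubic; move: r0n r1n; rewrite -!size_poly_gt0.
  by move: (size r0) (size r1) => u v; lia.
have r00 : r0 = 0 by apply/eqP; rewrite -sqrf_eq0 E r10 expr0n mul0r.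
by rewrite {1}Ep r10 r00 mul0r !addr0.
Qed.

Lemma sqr_eq4 (t : F) : t ^+ 2 = 4 -> (t - 2) * (t - - 2) = 0.
Proof. by move=> E; transitivity (t ^+ 2 - 4); [ring | rewrite E subrr]. Qed.

(** By halving, every point off the two nodal fibres is a double. If [g] were zero, [f] would vanish
    there, and multiplying by the equations of the two fibres covers the remaining points. *)
Lemma numerator_neq0 N (f g : A) : f != 0 -> numerator N f g -> g != 0.
Proof.
move=> f0 Hg; apply: contra_neq f0 => g0.
suff E : f * (fibre 2 * fibre (- 2)) = 0.
  by move/eqP: E; rewrite !mulf_eq0 !(negPf (fibre_neq0 _)) !orbF => /eqP.
apply: (poly3_vanish char0) => a b c; rewrite !rmorphM !eval3_fibre.
have [T4|T4] := eqVneq (gT a b ^+ 2) 4.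
  by rewrite (sqr_eq4 T4) mulr0.
have [a' [b' [c' [b'0 _ Ex Ey Ew]]]] := halving c (erefl (gT a b)) T4.
have y0 : eval3 a' b' c' vy != 0 by rewrite /eval3 subst3y.
have := Hg F (eval3 a' b' c') n2 y0; rewrite g0 rmorph0 => /esym/eqP.
rewrite mulf_eq0 expf_eq0 (negPf y0) andbF /= => /eqP.
have -> : dbl_hom (eval3 a' b' c') f = eval3 a b c f.
  move: f {Hg}; apply: rmorph3_eq => [d|||]; rewrite /dbl_hom /eval3 !subst3E ?Ex ?Ey ?Ew //.
  by rewrite /= subst3C.
by move=> ->; rewrite mul0r.
Qed.

Lemma two_torsion_jet a : jet_ideal (@delta F) (eval3 a 0 0) vy.
Proof.
move=> n; suff [u [v ->]] : exists u v, iter n (@delta F) vy = u * vy + v * vw.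
  by rewrite rmorphD !rmorphM /eval3 subst3y subst3w !mulr0 addr0.
elim: n => [|n [u [v E]]]; first by exists 1, 0; exact: lin_first.
exists (next_u vx vT (delta u) u v), (next_v vx vT (delta v) u v).
have dP := delta_der F.
rewrite iterS E (der_add dP) (der_mul dP u) (der_mul dP v) !deltaE; exact: next_uvE.
Qed.

Lemma torsion_jet_ideal_neq0 T0 k a b c :
  torsion T0 k a b c -> nonzero_ideal (jet_ideal (@delta F) (eval3 a b c)).
Proof.
elim: k a b c => [|k IHk] a b c.
  by move=> [-> -> _]; exists vy; split; [exact: two_torsion_jet | exact/eqP/vy_neq0].
move=> /= [b0 Tab /IHk[f [If f0]]].
have [N [g Hg]] := numerator_exists char0 f.
exists g; split; last by apply/eqP; apply: (numerator_neq0 _ Hg); apply/eqP.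
have y0 : eval3 a b c vy != 0 by rewrite /eval3 subst3y.
apply: (transport_jet char0 y0 _ Hg).
move=> n; rewrite -(If n); move: (iter n _ f); apply: rmorph3_eq => [d|||].
- by rewrite dbl_homC /eval3 !subst3C.
- by rewrite /dbl_hom /eval3 !subst3E.
- by rewrite /dbl_hom /eval3 !subst3E.
- by rewrite /dbl_hom /eval3 !subst3E.
Qed.

Theorem delta_meet_zero : nonzero_prime_diff_ideals_meet_zero (@delta F).
Proof.
move=> a Ha; apply: NNPP => a0.
(* The intersection is itself a differential ideal, so if nonzero it contains a nonzero polynomial
   free of [w]. *)
pose V (f : A) := forall I : A -> Prop, is_prime_ideal I ->
  is_differential_ideal (@delta F) I -> nonzero_ideal I -> I f.
have Vd : is_differential_ideal (@delta F) V.
  split; last by move=> f Vf I Ip Id In; case: (Id) => _; apply; apply: Vf.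
  split=> [I Ip [[I0 _ _] _] _|f g Vf Vg I Ip Id In|r f Vf I Ip Id In] //.
    by case: (Id) => [[_ ID _] _]; apply: ID; [apply: Vf | apply: Vg].
  by case: (Id) => [[_ _ IM] _]; apply: IM; apply: Vf.
have [p [p0 Vp]] := eliminate_w char0 closed Vd (ex_intro _ a (conj Ha a0)).
(* A point off the nodal fibres with [p] nonzero. As [p] vanishes at the torsion points of the fibre
   through it, that fibre's equation divides [p], a contradiction. *)
have [x [y Exy]] : exists x y, eval2 x y (p * (fibre2 2 * fibre2 (- 2))) != 0.
  apply: NNPP => none; have : p * (fibre2 2 * fibre2 (- 2)) = 0.
    apply: (poly2_vanish char0) => x y; apply/eqP/negPn/negP => n0.
    by apply: none; exists x, y.
  have f20 (T0 : F) : fibre2 T0 != 0 by rewrite -polyC_eq0 -fibreE fibre_neq0.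
  by move/eqP; rewrite !mulf_eq0 (negPf p0) !(negPf (f20 _)).
have ev2 (T0 : F) : eval2 x y (fibre2 T0) = gT x y - T0.
  by rewrite /fibre2 rmorphB rmorph_gT !eval2C !eval2X hornerX hornerC.
move: Exy; rewrite !rmorphM !ev2 !mulf_eq0 !negb_or => /and3P[px T2 Tm2].
have T4 : gT x y ^+ 2 != 4.
  have : (gT x y - 2) * (gT x y - - 2) != 0 by rewrite mulf_neq0.
  by apply: contra => /eqP/sqr_eq4 ->.
suff [q Eq] : exists q, p = q * fibre2 (gT x y).
  by move: px; rewrite Eq rmorphM ev2 subrr mulr0 eqxx.
apply: vanish_on_torsion => // k u v w t.
have := Vp _ (jet_ideal_prime (delta_der F) (eval3 u v w) char0)
  (jet_ideal_differential (delta_der F) (eval3 u v w)) (torsion_jet_ideal_neq0 t) 0%N.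
by rewrite /= /eval3 /subst3 psubstC.
Qed.
End Torsion.

(** * Adjoining a variable *)

(* No element of [Frac R] other than [0] satisfies [D u = (j - i) b u] with [i <> j]. *)
Definition no_exponential (R : comNzRingType) (d : R -> R) (b : R) :=
  forall (i j : nat) (p q : R), p != 0 -> q != 0 ->
    d p * q + i%:R * b * (p * q) = p * d q + j%:R * b * (p * q) -> i = j.

Lemma coefM_top (R : nzRingType) (p q : {poly R}) m n :
  (size p <= m.+1)%N -> (size q <= n.+1)%N -> (p * q)`_(m + n) = p`_m * q`_n.
Proof.
move=> sp sq; rewrite coefM.
have mn : (m < (m + n).+1)%N by lia.
rewrite (bigD1 (Ordinal mn)) //= big1 ?addr0 ?addKn // => i /eqP im.
have {}im : (i : nat) <> m by move=> E; apply: im; apply: val_inj.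
have [lt|ge] := ltnP i m.
  by rewrite [q`__]nth_default ?mulr0 //; apply: leq_trans sq _; lia.
by rewrite nth_default ?mul0r //; apply: leq_trans sp _; lia.
Qed.

Lemma size_polyM_le (R : nzRingType) (p q : {poly R}) m n k :
  (size p <= m)%N -> (size q <= n)%N -> (m + n <= k.+1)%N -> (size (p * q)%R <= k)%N.
Proof. by move=> sp sq mn; apply: leq_trans (size_polyMleq p q) _; lia. Qed.

Section Extension.
Variables (F : fieldType) (R : idomainType) (io : {rmorphism F -> R}) (d : R -> R) (b : R).
Hypothesis char0 : forall n, (n%:R == 0 :> F) = (n == 0%N).
Hypothesis dP : derivation_along (idfun : {rmorphism R -> R}) d.

Definition ext_der (f : {poly R}) : {poly R} := map_poly d f + f^`() * (b%:P * 'X).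

Lemma coef_ext_der f i : (ext_der f)`_i = d f`_i + i%:R * b * f`_i.
Proof.
rewrite /ext_der coefD coef_map_id0 ?(der0 dP) // mulrCA coefCM coefMX.
case: i => [|i]; first by rewrite /= mul0r mul0r mulr0.
by rewrite /= coef_deriv -mulr_natr; ring.
Qed.

Lemma ext_der_derivation : derivation_along (idfun : {rmorphism {poly R} -> {poly R}}) ext_der.
Proof.
apply: derivation_along_add; first exact: map_poly_derivation.
exact: derivation_along_scale (deriv_derivation R).
Qed.

Lemma ext_derC c : ext_der c%:P = (d c)%:P.
Proof. by rewrite /ext_der derivC mul0r addr0 map_polyC_der. Qed.

Lemma size_ext_der f : (size (ext_der f) <= size f)%N.
Proof.
apply/leq_sizeP => i le; rewrite coef_ext_der nth_default // (der0 dP); ring.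
Qed.

Hypothesis d_io : forall c, d (io c) = 0.
Hypothesis constants : forall n q, q != 0 -> d n * q = n * d q -> exists k, n = io k * q.
Hypothesis noexp : no_exponential d b.

(** In the top coefficients of the two products, [no_exponential] forces equal degrees, and then the
    leading coefficients have a constant ratio. *)
Lemma ext_constants_lead (f g : {poly R}) : f != 0 -> g != 0 ->
  ext_der f * g = f * ext_der g ->
  size f = size g /\ exists k, lead_coef f = io k * lead_coef g.
Proof.
move=> f0 g0 E.
have sf : (size f = (size f).-1.+1)%N by rewrite prednK // size_poly_gt0.
have sg : (size g = (size g).-1.+1)%N by rewrite prednK // size_poly_gt0.
have lf : lead_coef f != 0 by rewrite lead_coef_eq0.
have lg : lead_coef g != 0 by rewrite lead_coef_eq0.
have sef : (size (ext_der f) <= (size f).-1.+1)%N by rewrite -sf size_ext_der.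
have seg : (size (ext_der g) <= (size g).-1.+1)%N by rewrite -sg size_ext_der.
have Ec : (ext_der f * g)`_((size f).-1 + (size g).-1) = (f * ext_der g)`_((size f).-1 + (size g).-1).
  by rewrite E.
rewrite (coefM_top sef) -?sg // (coefM_top _ seg) -?sf // in Ec.
rewrite !coef_ext_der -!lead_coefE in Ec.
have E' : d (lead_coef f) * lead_coef g + (size f).-1%:R * b * (lead_coef f * lead_coef g) =
    lead_coef f * d (lead_coef g) + (size g).-1%:R * b * (lead_coef f * lead_coef g).
  transitivity ((d (lead_coef f) + (size f).-1%:R * b * lead_coef f) * lead_coef g); first by ring.
  by rewrite Ec; ring.
have ss := noexp lf lg E'; split; first by rewrite sf sg ss.
by apply: constants => //; move: E'; rewrite ss => /addIr.
Qed.

(** Subtracting the multiple of [g] with the same leading coefficient leaves a solution of smaller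
    degree, which must be zero because nonzero solutions have the degree of [g]. *)
Lemma ext_constants (f g : {poly R}) : g != 0 -> ext_der f * g = f * ext_der g ->
  exists k, f = (io k)%:P * g.
Proof.
move=> g0 E; have [->|f0] := eqVneq f 0; first by exists 0; rewrite rmorph0 polyC0 mul0r.
have [sfg [k Ek]] := ext_constants_lead f0 g0 E; exists k.
apply/eqP; rewrite -subr_eq0; apply/negPn/negP => h0.
have dE := ext_der_derivation.
have Eh : ext_der (f - (io k)%:P * g) * g = (f - (io k)%:P * g) * ext_der g.
  rewrite (der_add dE) (der_opp dE) (der_mul dE) ext_derC d_io polyC0 mul0r add0r /=.
  by rewrite mulrBl E; ring.
have [sh _] := ext_constants_lead h0 g0 Eh.
suff : (size (f - (io k)%:P * g)%R < size g)%N by rewrite sh ltnn.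
have sg : (size g = (size g).-1.+1)%N by rewrite prednK // size_poly_gt0.
rewrite sg; apply/leq_sizeP => j; rewrite leq_eqVlt => /orP[/eqP<-|lt].
  by rewrite coefB coefCM -[g`__]lead_coefE -Ek lead_coefE sfg subrr.
by rewrite coefB coefCM !nth_default ?mulr0 ?subrr ?sfg // sg.
Qed.

(** [ext_der] does not raise the degree in the new variable while multiplication by ['X] does, so
    ['X] can be the multiplier for the next variable. *)
Lemma ext_no_exponential : no_exponential ext_der 'X.
Proof.
move=> i j p q p0 q0 E.
have sp : (size p = (size p).-1.+1)%N by rewrite prednK // size_poly_gt0.
have sq : (size q = (size q).-1.+1)%N by rewrite prednK // size_poly_gt0.
set m := (size p).-1 in sp; set n := (size q).-1 in sq.
have hp : (size (ext_der p) <= m.+1)%N by rewrite -sp size_ext_der.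
have hq : (size (ext_der q) <= n.+1)%N by rewrite -sq size_ext_der.
have Epq : (p * q)`_(m + n) = lead_coef p * lead_coef q by rewrite coefM_top ?sp ?sq // !lead_coefE.
have hi : (size (ext_der p * q)%R <= (m + n).+1)%N.
  by apply: (size_polyM_le hp (n := n.+1)); rewrite ?sq // addSn addnS.
have hj : (size (p * ext_der q)%R <= (m + n).+1)%N.
  by apply: (size_polyM_le (m := m.+1) _ hq); rewrite ?sp // addSn addnS.
have cX k : (k%:R * 'X * (p * q))`_(m + n).+1 = (lead_coef p * lead_coef q) *+ k.
  by rewrite -mulrA mulr_natl coefMn coefXM /= Epq.
have := congr1 (fun r : {poly R} => r`_(m + n).+1) E; rewrite !coefD !cX !nth_default // !add0r.
have l0 : lead_coef p * lead_coef q != 0 by rewrite mulf_neq0 ?lead_coef_eq0.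
rewrite -[_ *+ i]mulr_natr -[_ *+ j]mulr_natr => /(mulfI l0).
rewrite -(rmorph_nat io i) -(rmorph_nat io j) => /(fmorph_inj io)/(natr_inj char0) //.
Qed.

(** A nonzero prime differential ideal [I] extends to [I[z]], which [ext_der] preserves; an element
    of all these extensions has its coefficients in every [I]. *)
Lemma ext_meet_zero : nonzero_prime_diff_ideals_meet_zero d ->
  nonzero_prime_diff_ideals_meet_zero ext_der.
Proof.
move=> meet f Hf; apply/polyP => i; rewrite coef0; apply: meet => I Ip [Iid Id] [x [Ix x0]].
have [_ ID IM] := Iid.
apply: (Hf (poly_ideal I)); first exact: prime_poly_ideal.
  split; first exact: poly_idealP.
  by move=> g Ig j; rewrite coef_ext_der; apply: ID; [apply: Id | apply: IM].
exists x%:P; split; last by move/eqP; rewrite polyC_eq0 => /eqP.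
by case=> [|j]; rewrite coefC //=; case: Iid.
Qed.
End Extension.

(** * No exponentials over the three-variable ring *)

Section BaseExponential.
Variable F : fieldType.
Hypothesis char0 : forall n, (n%:R == 0 :> F) = (n == 0%N).
Notation A := (poly3 F).

Lemma size_affine (S : comNzRingType) (c0 c1 : S) : (size (c0%:P + c1%:P * 'X)%R <= 2)%N.
Proof.
by apply/leq_sizeP => -[|[|j]] // _; rewrite !coefD !coefCM coefX coefC /= mulr0 addr0.
Qed.

Section SizeInW.
Variables (S : comNzRingType) (x y : S).
Lemma size_gX_w : (size (gX x%:P y%:P 'X)%R <= 2)%N.
Proof.
have -> : gX x%:P y%:P 'X = (4 * x ^+ 2 - 8 - 2 * gT x y * x)%:P + (2 * y)%:P * 'X.
  by rewrite /gX /gT !(rmorph_nat, rmorphXn, rmorphD, rmorphN, rmorphM); ring.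
exact: size_affine.
Qed.
Lemma size_gY_w : (size (gY x%:P y%:P 'X)%R <= 2)%N.
Proof.
have -> : gY x%:P y%:P 'X = (6 * x * y - 3 * gT x y * y)%:P + (3 * (x ^+ 2 - 1))%:P * 'X.
  by rewrite /gY /gT !(rmorph_nat, rmorph1, rmorphXn, rmorphD, rmorphN, rmorphM); ring.
exact: size_affine.
Qed.
Lemma size_gW_w : (size (gW x%:P y%:P 'X)%R <= 2)%N.
Proof.
have -> : gW x%:P y%:P 'X = (- 4 * y)%:P + (- 2 * x - gT x y)%:P * 'X.
  by rewrite /gW /gT !(rmorph_nat, rmorphXn, rmorphD, rmorphN, rmorphM); ring.
exact: size_affine.
Qed.
End SizeInW.

Lemma size_delta (f : A) : (size (delta f) <= (size f).+1)%N.
Proof.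
have sX : (size (gX vx vy vw : A) <= 2)%N by rewrite vxE vyE vwE size_gX_w.
have sY : (size (gY vx vy vw : A) <= 2)%N by rewrite vxE vyE vwE size_gY_w.
have sW : (size (gW vx vy vw : A) <= 2)%N by rewrite vxE vyE vwE size_gW_w.
have sx : (size (dx f) <= size f)%N by exact: size_poly.
have sy : (size (dy f) <= size f)%N by exact: size_poly.
have sw : (size (dw f) <= size f)%N by exact: leq_trans (size_poly _ _) (leq_pred _).
rewrite /delta; move: (gX _ _ _) (gY _ _ _) (gW _ _ _) sX sY sW => X Y W sX sY sW.
move: (dx f) (dy f) (dw f) (size f) sx sy sw => p q r n sp sq sr.
have bound (u v : A) : (size u <= n)%N -> (size v <= 2)%N -> (size (u * v)%R <= n.+1)%N.
  by move=> su sv; apply: (size_polyM_le su sv); rewrite addn2.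
apply: leq_trans (size_polyD _ _) _; rewrite geq_max (bound _ _ sr sW) andbT.
by apply: leq_trans (size_polyD _ _) _; rewrite geq_max !bound.
Qed.

(** [delta] raises the degree in [w] by at most one, multiplication by [vw ^+ 2] by two, so the top
    coefficients give [i = j]. *)
Lemma delta_no_exponential : no_exponential (@delta F) (vw ^+ 2).
Proof.
move=> i j p q p0 q0 E.
have sp : (size p = (size p).-1.+1)%N by rewrite prednK // size_poly_gt0.
have sq : (size q = (size q).-1.+1)%N by rewrite prednK // size_poly_gt0.
have := size_delta p; have := size_delta q.
set m := (size p).-1 in sp; set n := (size q).-1 in sq; rewrite sp sq => hq hp.
have Epq : (p * q)`_(m + n) = lead_coef p * lead_coef q by rewrite coefM_top ?sp ?sq // !lead_coefE.
have hi : (size (delta p * q)%R <= (m + n).+2)%N.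
  by apply: (size_polyM_le hp (n := n.+1)); rewrite ?sq // !addSn addnS.
have hj : (size (p * delta q)%R <= (m + n).+2)%N.
  by apply: (size_polyM_le (m := m.+1) _ hq); rewrite ?sp // addSn !addnS.
have cX k : (k%:R * vw ^+ 2 * (p * q))`_(m + n).+2 = (lead_coef p * lead_coef q) *+ k.
  by rewrite vwE -mulrA mulr_natl coefMn coefXnM subn2 /= Epq.
have := congr1 (fun r : A => r`_(m + n).+2) E; rewrite !coefD !cX !nth_default // !add0r.
have l0 : lead_coef p * lead_coef q != 0 by rewrite mulf_neq0 ?lead_coef_eq0.
rewrite -[_ *+ i]mulr_natr -[_ *+ j]mulr_natr => /(mulfI l0).
rewrite -(rmorph_nat (polyC \o polyC) i) -(rmorph_nat (polyC \o polyC) j).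
by move=> /polyC_inj/polyC_inj/(natr_inj char0).
Qed.
End BaseExponential.

(** * Krull dimension *)

Section IteratedPolynomials.
Variable F : fieldType.

Fixpoint mpolys (n : nat) : idomainType :=
  if n is m.+1 then ({poly (mpolys m)} : idomainType) else (F : idomainType).

Fixpoint mconst (n : nat) : {rmorphism F -> mpolys n} :=
  if n is m.+1 then (@polyC (mpolys m) \o mconst m : {rmorphism F -> {poly (mpolys m)}})
  else (idfun : {rmorphism F -> F}).

(** The degree is bounded in each variable separately, which makes the polynomials concerned a space
    of dimension [(N + 1)^n] with the coordinates below. *)
Fixpoint degle (n N : nat) : mpolys n -> Prop :=
  if n is m.+1 then
    fun f : {poly (mpolys m)} => (size f <= N.+1)%N /\ forall i, degle N f`_i
  else fun _ => True.

Lemma degle0 n N : degle N (0 : mpolys n).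
Proof.
elim: n => //= n IHn; split; first by rewrite size_poly0.
by move=> i; rewrite coef0.
Qed.

Lemma degleD n N (f g : mpolys n) : degle N f -> degle N g -> degle N (f + g).
Proof.
elim: n f g => //= n IHn f g [sf Hf] [sg Hg]; split.
  by apply: leq_trans (size_polyD _ _) _; rewrite geq_max sf sg.
by move=> i; rewrite coefD; apply: IHn.
Qed.

Lemma degleM n M N (f g : mpolys n) : degle M f -> degle N g -> degle (M + N) (f * g).
Proof.
elim: n f g => //= n IHn f g [sf Hf] [sg Hg]; split.
  by apply: leq_trans (size_polyMleq f g) _; move: sf sg; move: (size f) (size g) => u v; lia.
move=> i; rewrite coefM; apply: (big_ind (@degle n (M + N))); first exact: degle0.
  by move=> *; apply: degleD.
by move=> j _; apply: IHn.
Qed.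

Lemma degle_mono n M N (f : mpolys n) : (M <= N)%N -> degle M f -> degle N f.
Proof.
move=> le; elim: n f => //= n IHn f [sf Hf]; split; first by lia.
by move=> i; apply: IHn.
Qed.

Lemma degle_const n N c : degle N (mconst n c).
Proof.
elim: n => //= n IHn; split; first by apply: leq_trans (size_polyC_leq1 _) _.
by case=> [|i]; rewrite coefC //=; apply: degle0.
Qed.

Lemma degle_exists n (f : mpolys n) : exists N, degle N f.
Proof.
elim: n f => [|n IHn] f; first by exists 0%N.
have [N HN] : exists N, forall i, (i < size (f : {poly (mpolys n)}))%N -> degle N (f : {poly (mpolys n)})`_i.
  elim: (size _) => [|k [N HN]]; first by exists 0%N.
  have [M HM] := IHn (f : {poly (mpolys n)})`_k; exists (M + N)%N => i.
  rewrite ltnS leq_eqVlt => /orP[/eqP->|lt]; first by apply: degle_mono HM; lia.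
  by apply: (degle_mono _ (HN i lt)); lia.
exists (N + size (f : {poly (mpolys n)}))%N; split; first by lia.
move=> i; have [lt|ge] := ltnP i (size (f : {poly (mpolys n)})).
  by apply: (degle_mono _ (HN i lt)); lia.
by rewrite nth_default //; apply: degle0.
Qed.

(* The coefficients of [f], listed by the base [N + 1] expansion of the exponents. *)
Fixpoint coords (n N : nat) : mpolys n -> nat -> F :=
  if n is m.+1 then
    fun (f : {poly (mpolys m)}) k => coords N f`_(k %/ N.+1 ^ m) (k %% N.+1 ^ m)
  else fun f _ => f.

Fixpoint from_coords (n N : nat) (c : nat -> F) : mpolys n :=
  if n is m.+1 then
    (\poly_(i < N.+1) from_coords m N (fun j => c (i * N.+1 ^ m + j)%N) : {poly (mpolys m)})
  else c 0%N.

Lemma from_coords_ext n N c c' : (forall j, (j < N.+1 ^ n)%N -> c j = c' j) ->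
  from_coords n N c = from_coords n N c'.
Proof.
elim: n c c' => [|n IHn] c c' E; first exact: E.
rewrite /=; apply/polyP => i; rewrite !coef_poly; case: ltnP => // lti.
apply: IHn => j ltj; apply: E; rewrite expnS.
apply: (@leq_trans (i.+1 * N.+1 ^ n)%N); first by rewrite mulSn addnC ltn_add2r.
by rewrite leq_mul2r lti orbT.
Qed.

Lemma coordsK n N (f : mpolys n) : degle N f -> from_coords n N (coords N f) = f.
Proof.
elim: n f => [|n IHn] f //= [sf Hf].
apply/polyP => i; rewrite coef_poly; case: ltnP => [lti|ge]; last first.
  by rewrite nth_default //; apply: leq_trans sf ge.
rewrite -[RHS](IHn _ (Hf i)); apply: from_coords_ext => j ltj.
have q0 : (0 < N.+1 ^ n)%N by rewrite expn_gt0.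
by rewrite divnMDl // divn_small // addn0 modnMDl modn_small.
Qed.

Lemma coords_from n N c j : (j < N.+1 ^ n)%N -> coords N (from_coords n N c) j = c j.
Proof.
elim: n c j => [|n IHn] c j /=; first by rewrite expn0 ltnS leqn0 => /eqP->.
move=> ltj; have q0 : (0 < N.+1 ^ n)%N by rewrite expn_gt0.
rewrite coef_poly ltn_divLR // -expnS ltj IHn ?ltn_mod //.
by rewrite -divn_eq.
Qed.

Lemma degle_from n N c : degle N (from_coords n N c).
Proof.
elim: n c => //= n IHn c; split; first exact: size_poly.
by move=> i; rewrite coef_poly; case: ifP => _; [apply: IHn | apply: degle0].
Qed.

Lemma coordsD n N (f g : mpolys n) j : coords N (f + g) j = coords N f j + coords N g j.
Proof. by elim: n f g j => //= n IHn f g j; rewrite coefD IHn. Qed.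

Lemma coordsZ n N c (f : mpolys n) j : coords N (mconst n c * f) j = c * coords N f j.
Proof. by elim: n f j => //= n IHn f j; rewrite coefCM IHn. Qed.

Lemma coords0 n N j : coords N (0 : mpolys n) j = 0.
Proof. by elim: n j => //= n IHn j; rewrite coef0 IHn. Qed.

Lemma coords_sum n N (I : Type) (r : seq I) (P : pred I) (f : I -> mpolys n) j :
  coords N (\sum_(i <- r | P i) f i) j = \sum_(i <- r | P i) coords N (f i) j.
Proof. by apply: (big_morph (fun g => coords N g j)) => [u v|]; [apply: coordsD | apply: coords0]. Qed.

Section Evaluation.
Variables (A : idomainType) (io : {rmorphism F -> A}).

Fixpoint meval (n : nat) (a : nat -> A) : {rmorphism mpolys n -> A} :=
  if n is m.+1 then psubst (meval m (fun i => a i.+1)) (a 0%N) else io.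

Lemma meval_const n a c : meval n a (mconst n c) = io c.
Proof. by elim: n a => //= n IHn a; rewrite psubstC. Qed.
End Evaluation.

Lemma degle_meval m n (a : nat -> mpolys m) d N (f : mpolys n) :
  (forall i, (i < n)%N -> degle d (a i)) -> degle N f ->
  degle (n * N * d) (meval (mconst m) n a f).
Proof.
elim: n a f => [|n IHn] a f Ha; first by move=> _; apply: degle_const.
move=> /= [sf Hf]; rewrite /psubst /= /horner_morph.
rewrite (@horner_coef_wide _ N.+1); last by apply: leq_trans (size_poly _ _) sf.
apply: (big_ind (@degle m _)); first exact: degle0.
  by move=> *; apply: degleD.
move=> i _; rewrite coef_map /=.
have Hpow k : degle (k * d) (a 0%N ^+ k).
  elim: k => [|k IHk]; first by rewrite expr0 -(rmorph1 (mconst m)); apply: degle_const.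
  by rewrite exprS mulSn; apply: degleM => //; apply: Ha.
have := degleM (IHn (fun i => a i.+1) _ (fun i lti => Ha i.+1 lti) (Hf i)) (Hpow i).
apply: degle_mono; have := ltn_ord i; rewrite ltnS mulSn mulnDl addnC => le.
by rewrite leq_add2r leq_mul2r le orbT.
Qed.

(** Dimension count: the polynomials in [n + 1] variables outgrow the space in [n] variables that
    contains their values at [a]. *)
Lemma algebraic_dependence n (a : nat -> mpolys n) :
  exists f : mpolys n.+1, f != 0 /\ meval (mconst n) n.+1 a f = 0.
Proof.
have [d Hd] : exists d, forall i, (i < n.+1)%N -> degle d (a i).
  elim: n.+1 => [|k [d Hd]]; first by exists 0%N.
  have [e He] := degle_exists (a k); exists (d + e)%N => i.
  rewrite ltnS leq_eqVlt => /orP[/eqP->|lt]; first by apply: degle_mono He; lia.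
  by apply: (degle_mono _ (Hd i lt)); lia.
(* [M] and [D] are the dimensions of the source, with partial degrees at most [N], and of the
   target, with partial degrees at most [L]. As [L + 1 <= (N + 1) ((n + 1) d + 1)], this [N] gives
   [D <= (N + 1)^n N < M]. *)
pose N := ((n.+1 * d).+1 ^ n)%N; pose M := (N.+1 ^ n.+1)%N; pose L := (n.+1 * N * d)%N.
pose D := (L.+1 ^ n)%N.
have DM : (D < M)%N.
  have le : (L.+1 <= N.+1 * (n.+1 * d).+1)%N.
    by rewrite /L mulnAC mulSn mulnS [(n.+1 * d * N)%N]mulnC; lia.
  apply: (@leq_ltn_trans (N.+1 ^ n * N)%N); last by rewrite /M expnSr ltn_pmul2l // expn_gt0.
  have mono k : (L.+1 ^ k <= (N.+1 * (n.+1 * d).+1) ^ k)%N.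
    by elim: k => // k IHk; rewrite !expnS leq_mul.
  by apply: leq_trans (mono n) _; rewrite expnMn.
pose e (j : nat) : mpolys n.+1 := from_coords n.+1 N (fun k => (k == j)%:R).
(* The matrix of evaluation at [a]; with more rows than columns it has a nonzero left kernel
   vector. *)
pose B : 'M[F]_(M, D) := \matrix_(i, j) coords L (meval (mconst n) n.+1 a (e i)) j.
have rkB : (\rank (kermx B) != 0)%N.
  by rewrite mxrank_ker -lt0n subn_gt0; apply: leq_ltn_trans (rank_leq_col B) DM.
have [u [u0 uB]] : exists u : 'rV[F]_M, u != 0 /\ u *m B = 0.
  have /rowV0Pn[u uk u0] : kermx B != 0 by rewrite -mxrank_eq0.
  by exists u; split=> //; apply/sub_kermxP.
pose f := \sum_(i < M) mconst n.+1 (u 0 i) * e i.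
exists f; split.
  apply: contra_neq u0 => f0; apply/rowP => i; rewrite mxE.
  transitivity (coords N f i); last by rewrite f0 coords0.
  rewrite /f coords_sum (bigD1 i) // big1 => [|k ki].
    by rewrite Monoid.mulm1 coordsZ coords_from // eqxx mulr1.
  rewrite coordsZ coords_from // eq_sym.
  by rewrite -[(k : nat) == i]/(k == i) (negPf ki) mulr0.
have Ef : meval (mconst n) n.+1 a f = \sum_(i < M) mconst n (u 0 i) * meval (mconst n) n.+1 a (e i).
  by rewrite /f rmorph_sum; apply: eq_bigr => i _; rewrite rmorphM meval_const.
have degf : degle L (meval (mconst n) n.+1 a f).
  rewrite Ef; apply: (big_ind (@degle n L)); first exact: degle0.
    by move=> *; apply: degleD.
  move=> i _; rewrite -[L]add0n; apply: degleM; first exact: degle_const.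
  by apply: degle_meval => //; apply: degle_from.
rewrite -(coordsK degf) -(coordsK (degle0 n L)); apply: from_coords_ext => j ltj.
rewrite coords0 Ef coords_sum; have /rowP/(_ (Ordinal ltj)) := uB.
rewrite !mxE => H; rewrite -[RHS]H; apply: eq_bigr => i _; by rewrite coordsZ mxE.
Qed.

(* Divide [f] by the largest power of its outermost variable; the rest is nonzero modulo it. *)
Lemma chain_no_relation (A : idomainType) (io : {rmorphism F -> A}) k (f : mpolys k)
    (a : nat -> A) (P : nat -> A -> Prop) :
  (forall i, (i <= k)%N -> is_prime_ideal (P i)) ->
  (forall i, (i < k)%N -> [/\ forall x, P i x -> P i.+1 x, P i.+1 (a i) & ~ P i (a i)]) ->
  f != 0 -> ~ P 0%N (meval io k a f).
Proof.
elim: k f a P => [|k IHk] f a P Pp Pa f0.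
  have [[_ _ PM] P1 _] := Pp 0%N isT; move=> /(PM (io f^-1)) /=.
  by rewrite -rmorphM mulVf // rmorph1.
have [j [g]] := multiplicity_XsubC (f : {poly (mpolys k)}) 0.
rewrite f0 /= => g0 Ef; have [Pid P1 PP] := Pp 0%N isT.
have [P01 P1a P0a] := Pa 0%N isT.
have [[_ PD1 PM1] _ _] := Pp 1%N isT.
rewrite Ef subr0 rmorphM rmorphXn /= psubstX => Pg.
have {}Pg : P 0%N (psubst (meval io k (fun i => a i.+1)) (a 0%N) g).
  elim: j {Ef} Pg => [|j IHj]; first by rewrite expr0 mulr1.
  by rewrite exprSr mulrA => /PP[/IHj|/P0a].
apply: (IHk g`_0 (fun i => a i.+1) (fun i => P i.+1)).
- by move=> i lei; apply: Pp.
- by move=> i lti; apply: Pa.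
- by rewrite -horner_coef0.
(* [a 0] lies in [P 1], so modulo [P 1] the value of [g] is that of its constant coefficient, a
   polynomial in the remaining variables. *)
have /factor_theorem[q Eq] : root (g - (g`_0)%:P) 0.
  by rewrite rootE hornerD hornerN hornerC horner_coef0 subrr.
rewrite subr0 in Eq; rewrite -(psubstC _ (a 0%N)).
have -> : (g`_0)%:P = g - q * 'X by rewrite -Eq opprB addrC subrK.
rewrite rmorphB; apply: PD1; first exact: P01.
by rewrite -mulN1r rmorphM psubstX mulrA; apply: PM1.
Qed.

(** The preimages of a chain under ['X = 0], preceded by the extension of its bottom ideal, which
    does not contain ['X]. *)
Lemma mpolys_prime_chain n : prime_chain (mpolys n) n.
Proof.
elim: n => [|n [P [Pp Pc]]].
  exists (fun _ x => x = 0); split=> // i _; split.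
  - by split=> // [x y -> ->|r x ->]; rewrite ?addr0 ?mulr0.
  - by apply/eqP; rewrite oner_eq0.
  - by move=> x y /eqP; rewrite mulf_eq0 => /orP[]/eqP; [left|right].
exists (fun i => if i is i'.+1 then fun f : {poly (mpolys n)} => P i' f`_0 else poly_ideal (P 0%N)).
split=> [[|i] lei|[|i] lti].
- by apply: prime_poly_ideal; apply: Pp.
- have [[P0 PD PM] P1 PP] := Pp i lei; split; first split.
  + by rewrite coef0.
  + by move=> f g; rewrite coefD; apply: PD.
  + by move=> f g; rewrite coef0M; apply: PM.
  + by rewrite coef1.
  + by move=> f g; rewrite coef0M; apply: PP.
- have [[P0 _ _] P1 _] := Pp 0%N isT; split; first by move=> f; apply.
  by exists 'X; rewrite coefX /=; split=> // /(_ 1%N); rewrite coefX.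
have [Pi [x [Px nPx]]] := Pc i lti; split; first by move=> f; apply: Pi.
by exists x%:P; rewrite coefC.
Qed.

(** For the upper bound, one element from each step of a chain of length [n + 1] would give [n + 1]
    elements without a polynomial relation, against [algebraic_dependence]. *)
Lemma mpolys_krull_dim n : krull_dim (mpolys n) n.
Proof.
split; first exact: mpolys_prime_chain.
move=> [P [Pp Pc]].
have [a Ha] : exists a : nat -> mpolys n, forall i, (i < n.+1)%N -> P i.+1 (a i) /\ ~ P i (a i).
  apply: (functional_choice (fun i x => (i < n.+1)%N -> P i.+1 x /\ ~ P i x)) => i.
  case: (ltnP i n.+1) => [lti|_]; last by exists 0.
  by have [_ [x Hx]] := Pc i lti; exists x.
have [f [f0 Ef]] := algebraic_dependence a.
apply: (@chain_no_relation (mpolys n) (mconst n) n.+1 f a P Pp _ f0).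
  by move=> i lti; have [? ?] := Ha i lti; have [? _] := Pc i lti.
by rewrite Ef; have [[]] := Pp 0%N isT.
Qed.
End IteratedPolynomials.

(** * The examples *)

Lemma CC_char0 n : (n%:R == 0 :> CC) = (n == 0%N).
Proof. exact: (@Num.Theory.pnatr_eq0 (Rdefinitions.R[i]) n). Qed.

Lemma CC_closed (p : {poly CC}) : (1 < size p)%N -> exists x, root p x.
Proof.
move=> sp; apply/(@closed_rootP (Rdefinitions.R[i]) p).
by apply/eqP => E; rewrite E in sp.
Qed.

Section Examples.
Variable R : idomainType.
Variable io : {rmorphism CC -> R}.

(** The data carried from one dimension to the next: constants are described without fractions, and
    [b] is the multiplier for the next variable. *)
Definition extensible_example (d : R -> R) (b : R) :=
  [/\ derivation_along (idfun : {rmorphism R -> R}) d,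
      forall c, d (io c) = 0,
      forall n q, q != 0 -> d n * q = n * d q -> exists k, n = io k * q,
      no_exponential d b
    & nonzero_prime_diff_ideals_meet_zero d].

Lemma extensible_constants d b : extensible_example d b -> constants_are_C io d.
Proof.
move=> [dP dC cst _ _] f; split=> [|[c ->]]; last by rewrite frac_delta_tofrac // dC rmorph0.
have [Ef q0] := fractionE f; move: (repr f) Ef q0 => nd -> q0 /(frac_delta_eq0 dP _ q0) E.
have [k ->] := cst _ _ q0 E; by exists k; rewrite tofracM mulfK // tofrac_eq0.
Qed.

Lemma extensible_good d b : complex_affine_algebra io -> extensible_example d b ->
  good_example io d.
Proof.
move=> fg ex; have cst := extensible_constants ex; have [dP dC _ _ meet] := ex.
split=> //; split=> [x y|x y|c x].
- exact: (der_add dP).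
- exact: (der_mul dP).
- by rewrite (der_mul dP) dC mul0r add0r.
Qed.
End Examples.

Lemma mpolys_finitely_generated n : complex_affine_algebra (mconst CC n).
Proof.
elim: n => [|n [s Hs]]; first by exists [::] => S SC _ _ _ a; apply: (SC a).
exists (('X : {poly mpolys CC n}) :: map polyC s) => S SC SD SM Ss.
apply: poly_generated => // [c|]; last by apply: Ss; rewrite mem_head.
apply: (Hs (fun a : mpolys CC n => S (a%:P : {poly mpolys CC n}))) => // [x y|x y|x xs].
- by rewrite polyCD; apply: SD.
- by rewrite polyCM; apply: SM.
- by apply: Ss; rewrite inE map_f ?orbT.
Qed.

Lemma example_three : exists d b, @extensible_example (mpolys CC 3) (mconst CC 3) d b.
Proof.
have Ec c : mconst CC 3 c = const3 c :> poly3 CC by rewrite const3E.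
exists (@delta CC), (vw ^+ 2); split.
- exact: delta_der.
- by move=> c; rewrite Ec deltaE.
- move=> n q q0 E; have [k Ek] := delta_constants CC_char0 CC_closed q0 E.
  by exists k; rewrite Ec.
- exact: (delta_no_exponential CC_char0).
- exact: (delta_meet_zero CC_char0 CC_closed).
Qed.

Lemma example_step n : (exists d b, @extensible_example (mpolys CC n) (mconst CC n) d b) ->
  exists d b, @extensible_example (mpolys CC n.+1) (mconst CC n.+1) d b.
Proof.
move=> [d [b [dP dC cst noexp meet]]].
exists (ext_der d b), ('X : {poly mpolys CC n}); split.
- exact: ext_der_derivation.
- by move=> c; rewrite /= ext_derC // dC.
- by move=> f g g0 E; have [k Ek] := ext_constants dP dC cst noexp g0 E; exists k.
- exact: (ext_no_exponential (mconst CC n) CC_char0).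
- exact: ext_meet_zero.
Qed.

Lemma example_dim n : (3 <= n)%N ->
  exists (A : idomainType) (iota : {rmorphism CC -> A}) (delta : A -> A),
    good_example iota delta /\ krull_dim A n.
Proof.
move=> le; have [d [b ex]] : exists d b, @extensible_example (mpolys CC n) (mconst CC n) d b.
  rewrite -(subnK le); elim: (n - 3)%N => [|k IHk]; first exact: example_three.
  exact: example_step.
exists (mpolys CC n), (mconst CC n), d; split; last exact: mpolys_krull_dim.
exact: extensible_good (mpolys_finitely_generated n) ex.
Qed.

Theorem theorem4p1 :
  (exists (A : idomainType) (iota : {rmorphism CC -> A}) (delta : A -> A),
      good_example iota delta) /\
  (forall n : nat, (3 <= n)%N ->
     exists (A : idomainType) (iota : {rmorphism CC -> A}) (delta : A -> A),
       good_example iota delta /\ krull_dim A n).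
Proof.
split; last exact: example_dim.
by have [A [iota [d [good _]]]] := @example_dim 3 isT; exists A, iota, d.
Qed.
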